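(* Let $\phi$ be a smooth function on $\{(T,X)\in[0,\infty)\times\mathbb{R}^3: R=|X|>0\}$ satisfying there the source-free ugly equation with $p=1$, $$\square\phi=\frac{2}{R}\,\partial_T\phi .$$ Suppose that $\phi_1:=R\,\nabla_{\underline\psi}\phi=R(\partial_T\phi-\partial_R\phi)$ extends to a function in $C^\infty([0,\infty)\times\mathbb{R}^3)$ and that its initial data $\phi_1|_{T=0}$ and $\partial_T\phi_1|_{T=0}$ have compact support in $\mathbb{R}^3$. Then the quantity $$(1+T+R)\,(1+|T-R|)^{1/2}\,\big|R\,\nabla_{\underline\psi}\phi(T,X)\big|$$ is bounded uniformly in $T\ge 0$ and $X\in\mathbb{R}^3\setminus\{0\}$. In particular there is a constant $C$ such that for all $T\geq 0$ and $X\neq0$, $$|\nabla_{\underline\psi}\phi(T,X)|\le\frac{C}{R\,(1+T+R)} .$$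
   Context: Work in Minkowski spacetime $\mathbb{R}\times\mathbb{R}^3$ with inertial Cartesian coordinates $(T,X^1,X^2,X^3)$ and signature $(-,+,+,+)$. Let $R=|X|$, with associated spherical polar coordinates $(T,R,\theta^A)$. The wave operator is $\square=-\partial_T^2+\sum_{i=1}^3\partial_{X^i}^2$. The incoming null vector field is $\underline\psi=\partial_T-\partial_R$, and $\nabla_{\underline\psi}f=\partial_Tf-\partial_Rf$ for scalar functions $f$. For a natural number $p$, an ''ugly equation'' is $\square\phi=\frac{2p}{R}\partial_T\phi+F$ with given source $F$. *)

(* Defs.v *)
From Stdlib Require Import Reals List.
From Coquelicot Require Import Coquelicot.
Open Scope R_scope.

Definition space := (R * R * R)%type.
(** An event [(T, X)]; functions on it are total, only their values at times
    [T >= 0] (and, where relevant, [X <> 0]) matter below. *)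
Definition event := (R * space)%type.

Definition radius (X : space) : R :=
  let '(x1, x2, x3) := X in sqrt (x1 ^ 2 + x2 ^ 2 + x3 ^ 2).

Definition dilate (a : R) (X : space) : space :=
  let '(x1, x2, x3) := X in (a * x1, a * x2, a * x3).

Definition half_space (p : event) : Prop := 0 <= fst p.
Definition punctured_half_space (p : event) : Prop :=
  0 <= fst p /\ 0 < radius (snd p).

Inductive axis := axT | ax1 | ax2 | ax3.

Definition coordinate (i : axis) (p : event) : R :=
  let '(T, (x1, x2, x3)) := p in
  match i with axT => T | ax1 => x1 | ax2 => x2 | ax3 => x3 end.

Definition set_coordinate (i : axis) (p : event) (s : R) : event :=
  let '(T, (x1, x2, x3)) := p in
  match i with
  | axT => (s, (x1, x2, x3))
  | ax1 => (T, (s, x2, x3))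
  | ax2 => (T, (x1, s, x3))
  | ax3 => (T, (x1, x2, s))
  end.

(** [is_derive] relativized to [T >= 0]: the usual partial derivative, except
    that [axT] gives the right derivative at [T = 0]. *)
Definition is_partial (i : axis) (f : event -> R) (p : event) (l : R) : Prop :=
  filterdiff (fun s => f (set_coordinate i p s))
    (within (fun s => half_space (set_coordinate i p s))
       (locally (coordinate i p)))
    (fun h => scal h l).

(** Like [Derive], meaningful only where the derivative exists. *)
Definition partial (i : axis) (f : event -> R) (p : event) : R :=
  iota (is_partial i f p).

(** [C^n] on [D], for [D] relatively open in the half-space [T >= 0]: all
    iterated partial derivatives of order at most [n] exist on [D] (one-sided in
    [T] on the boundary [T = 0]) and are continuous on [D], boundary included. *)
Fixpoint C_n (n : nat) (D : event -> Prop) (f : event -> R) : Prop :=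
  continuous_on D f /\
  match n with
  | O => True
  | S m => forall i : axis,
      (forall p, D p -> exists l, is_partial i f p l) /\ C_n m D (partial i f)
  end.

Definition smooth_on (D : event -> Prop) (f : event -> R) : Prop :=
  forall n : nat, C_n n D f.

Definition box (f : event -> R) (p : event) : R :=
  - partial axT (partial axT f) p
  + partial ax1 (partial ax1 f) p
  + partial ax2 (partial ax2 f) p
  + partial ax3 (partial ax3 f) p.

(** [d/dR] in spherical polar coordinates, i.e. at fixed [T] and fixed direction
    [X / |X|]; for [X <> 0]. *)
Definition d_R (f : event -> R) (p : event) : R :=
  let '(T, X) := p in
  Derive (fun s => f (T, dilate (s / radius X) X)) (radius X).

Definition nabla_psi (f : event -> R) (p : event) : R :=
  partial axT f p - d_R f p.

Definition is_compact {U : UniformSpace} (K : U -> Prop) : Prop :=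
  forall cover : (U -> Prop) -> Prop,
    (forall O, cover O -> open O) ->
    (forall x, K x -> exists O, cover O /\ O x) ->
    exists l : list (U -> Prop),
      (forall O, In O l -> cover O) /\
      (forall x, K x -> exists O, In O l /\ O x).

(** The closure of [{x | g x <> 0}]. *)
Definition support {U : UniformSpace} (g : U -> R) (x : U) : Prop :=
  ~ locally x (fun y => ~ g y <> 0).

Definition compactly_supported {U : UniformSpace} (g : U -> R) : Prop :=
  is_compact (support g).

(* Main.v *)
Require Import Defs.
From Stdlib Require Import Reals Lra Psatz Nsatz Classical ClassicalEpsilon List.
From Coquelicot Require Import Coquelicot.
Open Scope R_scope.

(** With [L = d_T + d_R] and [L' = d_T - d_R], the ugly equation with [p = 1] is
    [L L' phi + (2/R) L' phi = R^-2 Delta_{S^2} phi], and [phi1 = R L' phi] turns out to solve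
    the free wave equation: in Cartesian coordinates
    [box (R d_T phi - x^j d_j phi) = -2 (box phi - (2/R) d_T phi)] modulo derivatives of the
    ugly equation. By continuity this also holds on the axis [R = 0].

    For a solution [u] of the wave equation, the integral over the unit sphere of
    [u + r (u_T + omega . grad u)], taken at [(T - r, X + r omega)], is independent of [r], because
    its [r]-derivative is a divergence on the sphere. Comparing [r = 0] with [r = T] gives
    Kirchhoff's formula. With the polar axis pointing at the origin, the sphere of radius [T]
    around [X] meets the support of the data, a ball of radius [rho], only if [|T - R| <= rho], and
    then in a polar cap of area [O((rho / T)^2)]; hence [u = O(1 / T)] in the strip
    [|T - R| <= rho] and [u = 0] outside of it. *)

(** Up to the factor [4 * PI], the spherical integral is for each [r] Kirchhoff's expression for
    [u (T, X)] in terms of data on the slice at time [T - r]. Moving that slice replaces the usual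
    detour through spherical means and their one-dimensional wave equation. No surface measure is
    needed: iterated integrals in polar angles suffice once every integrand carries its own factor
    [sin th].

    The delicate place is [T = 0], where time derivatives are one-sided and nothing is given below.
    A solution is therefore handled as a jet of separate continuous functions on all events, linked
    by differentiation at positive times only; the initial slice is reached by continuity alone.

    The rate [1 / T] balances a flux of size [O(T)] against the small cap. Since integrands must be
    continuous, the cap is measured by a continuous majorant in place of its indicator function. The
    weight in [|T - R|] then costs only a constant, being bounded on the strip. *)

(** * Chain rules along curves and integrals depending on a parameter *)

Lemma continuous_pair {U V W : UniformSpace} (f : U -> V) (g : U -> W) (x : U) :
  continuous f x -> continuous g x -> continuous (fun u => (f u, g u)) x.
Proof.
  intros Hf Hg P [eps HP].
  assert (H1 := Hf _ (locally_ball (f x) eps)).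
  assert (H2 := Hg _ (locally_ball (g x) eps)).
  unfold filtermap in *; generalize (filter_and _ _ H1 H2).
  apply filter_imp; intros u [B1 B2]; apply HP; split; assumption.
Qed.

Lemma continuous_event {U : UniformSpace} (gT g1 g2 g3 : U -> R) (u : U) :
  continuous gT u -> continuous g1 u -> continuous g2 u -> continuous g3 u ->
  continuous (fun v => (gT v, (g1 v, g2 v, g3 v)) : event) u.
Proof.
  intros; repeat apply continuous_pair; assumption.
Qed.

Lemma continuous_2d_iff (f : R -> R -> R) (x y : R) :
  continuity_2d_pt f x y <-> continuous (fun z => f (fst z) (snd z)) (x, y).
Proof. apply continuity_2d_pt_filterlim. Qed.

(** Differentiability in two variables needs continuity of one partial derivative only; the other
    has to exist just at the point. This asymmetry allows coordinates to be peeled off one at a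
    time. *)
Lemma is_derive_comp_param (F F1 : R -> R -> R) (a : R -> R) (s a' l : R) :
  is_derive a s a' ->
  locally (a s, s) (fun u => is_derive (fun x => F x (snd u)) (fst u) (F1 (fst u) (snd u))) ->
  continuous (fun u => F1 (fst u) (snd u)) (a s, s) ->
  is_derive (F (a s)) s l ->
  is_derive (fun t => F (a t) t) s (a' * F1 (a s) s + l).
Proof.
  intros Ha HF HF1 Hl.
  pose proof (is_derive_filterdiff F (a s) s F1 l HF Hl HF1) as H.
  pose proof (filterdiff_comp'_2 a (fun t : R => t) F s (fun y => scal y a')
    (fun y => y) (fun u v => plus (scal u (F1 (a s) s)) (scal v l)) Ha
    (filterdiff_id _) H) as H2.
  unfold is_derive; eapply filterdiff_ext_lin; [exact H2|].
  intros y; unfold plus, scal; simpl; unfold mult; simpl; ring.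
Qed.

Definition has_partials (f : event -> R) (D : axis -> event -> R) (p : event) : Prop :=
  forall i, is_derive (fun s => f (set_coordinate i p s)) (coordinate i p) (D i p).

Lemma is_derive_continuous (f : R -> R) (x l : R) : is_derive f x l -> continuous f x.
Proof. intros H; apply (ex_derive_continuous (V := R_NormedModule)); exists l; exact H. Qed.

(** The coordinates are peeled off in the order [T], 1, 2, 3, each being frozen at its value at [s]
    once its contribution has been extracted. *)
Lemma is_derive_curve (f : event -> R) (D : axis -> event -> R)
    (gT g1 g2 g3 : R -> R) (dT d1 d2 d3 s : R) :
  let p : event := (gT s, (g1 s, g2 s, g3 s)) in
  locally p (has_partials f D) ->
  (forall i, continuous (D i) p) ->
  is_derive gT s dT -> is_derive g1 s d1 -> is_derive g2 s d2 -> is_derive g3 s d3 ->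
  is_derive (fun t => f (gT t, (g1 t, g2 t, g3 t))) s
    (dT * D axT p + (d1 * D ax1 p + (d2 * D ax2 p + d3 * D ax3 p))).
Proof.
  intros p Hloc HD HT H1 H2 H3.
  assert (cT := is_derive_continuous _ _ _ HT).
  assert (c1 := is_derive_continuous _ _ _ H1).
  assert (c2 := is_derive_continuous _ _ _ H2).
  assert (c3 := is_derive_continuous _ _ _ H3).
  assert (cfst : forall z : R * R, continuous (fst : R * R -> R) z)
    by (intros; apply (continuous_fst (U := R_UniformSpace) (V := R_UniformSpace))).
  assert (csnd : forall (g : R -> R) (x : R), continuous g s ->
            continuous (fun z : R * R => g (snd z)) (x, s)).
  { intros g x Hg. apply (continuous_comp (snd : R * R -> R) g); [|exact Hg].
    apply (continuous_snd (U := R_UniformSpace) (V := R_UniformSpace)). }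
  apply (is_derive_comp_param (fun x t => f (x, (g1 t, g2 t, g3 t)))
           (fun x t => D axT (x, (g1 t, g2 t, g3 t))) gT s); [exact HT| | | ].
  { assert (C : continuous (fun u : R * R => (fst u, (g1 (snd u), g2 (snd u), g3 (snd u))) : event) (gT s, s))
      by (apply continuous_event; auto).
    generalize (C _ Hloc); unfold filtermap; apply filter_imp.
    intros u Hu; exact (Hu axT). }
  { apply (continuous_comp (fun u : R * R => (fst u, (g1 (snd u), g2 (snd u), g3 (snd u))) : event) (D axT)).
    apply continuous_event; auto. exact (HD axT). }
  apply (is_derive_comp_param (fun x t => f (gT s, (x, g2 t, g3 t)))
           (fun x t => D ax1 (gT s, (x, g2 t, g3 t))) g1 s); [exact H1| | | ].
  { assert (C : continuous (fun u : R * R => (gT s, (fst u, g2 (snd u), g3 (snd u))) : event) (g1 s, s))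
      by (apply continuous_event; auto; apply continuous_const).
    generalize (C _ Hloc); unfold filtermap; apply filter_imp.
    intros u Hu; exact (Hu ax1). }
  { apply (continuous_comp (fun u : R * R => (gT s, (fst u, g2 (snd u), g3 (snd u))) : event) (D ax1)).
    apply continuous_event; auto; apply continuous_const. exact (HD ax1). }
  apply (is_derive_comp_param (fun x t => f (gT s, (g1 s, x, g3 t)))
           (fun x t => D ax2 (gT s, (g1 s, x, g3 t))) g2 s); [exact H2| | | ].
  { assert (C : continuous (fun u : R * R => (gT s, (g1 s, fst u, g3 (snd u))) : event) (g2 s, s))
      by (apply continuous_event; auto; apply continuous_const).
    generalize (C _ Hloc); unfold filtermap; apply filter_imp.
    intros u Hu; exact (Hu ax2). }
  { apply (continuous_comp (fun u : R * R => (gT s, (g1 s, fst u, g3 (snd u))) : event) (D ax2)).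
    apply continuous_event; auto; apply continuous_const. exact (HD ax2). }
  apply (is_derive_comp (fun x => f (gT s, (g1 s, g2 s, x))) g3 s (D ax3 p) d3); [|exact H3].
  exact (locally_singleton _ _ Hloc ax3).
Qed.

(** A tube lemma: the neighbourhoods given by joint continuity at each [(u0, t)] are made uniform in
    [t] by compactness of the segment, so the parameter space [U] can be arbitrary. *)
Lemma locally_uniform_on_segment {U : UniformSpace} (f : U -> R -> R) (a b : R) (u0 : U) :
  (forall t, a <= t <= b -> continuous (fun z => f (fst z) (snd z)) (u0, t)) ->
  forall eps : posreal,
  locally u0 (fun u => forall t, a <= t <= b -> Rabs (f u t - f u0 t) < eps).
Proof.
  intros Hf eps.
  assert (Hd : forall t, exists d : posreal, a <= t <= b -> forall u x,
    ball u0 d u -> Rabs (x - t) < d -> Rabs (f u x - f u0 t) < eps / 2).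
  { intros t. destruct (classic (a <= t <= b)) as [Ht|Ht].
    - assert (He : 0 < eps / 2) by (generalize (cond_pos eps); lra).
      destruct (Hf t Ht _ (locally_ball (f u0 t) (mkposreal _ He))) as [d Hd].
      exists d; intros _ u x Hu Hx.
      exact (Hd (u, x) (conj Hu Hx)).
    - exists (mkposreal 1 Rlt_0_1); tauto. }
  destruct (choice _ Hd) as [delta Hdelta].
  destruct (compactness_value_1d a b delta) as [d Hcov].
  exists d; intros u Hu x Hx.
  (* [compactness_value_1d] provides its point [t] only under a double negation. *)
  apply NNPP; intro Hn; apply (Hcov x Hx); intros [t (Ht & Hxt & Hdt)]; apply Hn.
  assert (B : forall v, ball u0 d v -> ball u0 (delta t) v)
    by (intros v Hv; apply ball_le with d; assumption).
  assert (E1 := Hdelta t Ht u x (B _ Hu) Hxt).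
  assert (E2 := Hdelta t Ht u0 x (ball_center _ _) Hxt).
  apply Rabs_def2 in E1; apply Rabs_def2 in E2; apply Rabs_def1; lra.
Qed.

Lemma continuous_slice {U : UniformSpace} (f : U -> R -> R) (u : U) (t : R) :
  continuous (fun z => f (fst z) (snd z)) (u, t) -> continuous (f u) t.
Proof.
  intros H.
  apply (continuous_comp (fun t : R => (u, t)) (fun z => f (fst z) (snd z))); [|exact H].
  apply continuous_pair; [apply continuous_const|apply continuous_id].
Qed.

Lemma continuous_RInt_param {U : UniformSpace} (f : U -> R -> R) (a b : R) :
  a <= b ->
  (forall z, continuous (fun z => f (fst z) (snd z)) z) ->
  forall u0, continuous (fun u => RInt (f u) a b) u0.
Proof.
  intros Hab Hf u0.
  assert (Hex : forall u, ex_RInt (f u) a b).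
  { intros u; apply (ex_RInt_continuous (V := R_CompleteNormedModule)).
    intros t _; apply continuous_slice, Hf. }
  apply filterlim_locally; intros eps.
  (* The [+ 1] covers [a = b] and makes the final inequality strict. *)
  assert (He : 0 < eps / (b - a + 1)) by (apply Rdiv_lt_0_compat; [apply cond_pos|lra]).
  generalize (locally_uniform_on_segment f a b u0 (fun t _ => Hf (u0, t)) (mkposreal _ He)).
  apply filter_imp; intros u Hu.
  change (Rabs (RInt (f u) a b - RInt (f u0) a b) < eps).
  replace (RInt (f u) a b - RInt (f u0) a b) with (RInt (fun t => f u t - f u0 t) a b)
    by (apply (RInt_minus (V := R_CompleteNormedModule)); auto).
  apply Rle_lt_trans with ((b - a) * (eps / (b - a + 1))).
  - apply abs_RInt_le_const; [assumption| |].
    + apply (ex_RInt_minus (V := R_CompleteNormedModule)); auto.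
    + intros t Ht; left; apply (Hu t Ht).
  - replace (pos eps) with ((b - a + 1) * (eps / (b - a + 1))) at 2 by (field; lra).
    simpl in He. nra.
Qed.

Lemma is_derive_under_RInt (f f' : R -> R -> R) (a b x : R) :
  a <= b ->
  locally x (fun y => forall t, is_derive (fun u => f u t) y (f' y t)) ->
  (forall y t, continuous (f y) t) ->
  (forall z, continuous (fun z => f' (fst z) (snd z)) z) ->
  is_derive (fun y => RInt (f y) a b) x (RInt (f' x) a b).
Proof.
  intros Hab Hd Hc Hc'.
  replace (RInt (f' x) a b) with (RInt (fun t => Derive (fun u => f u t) x) a b).
  2:{ apply RInt_ext; intros t _; apply is_derive_unique.
      exact (locally_singleton _ _ Hd t). }
  apply is_derive_RInt_param.
  - generalize Hd; apply filter_imp; intros y Hy t _; exists (f' y t); apply Hy.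
  - intros t _.
    apply continuity_2d_pt_ext_loc with (f := f').
    + apply locally_2d_locally.
      destruct Hd as [d Hd]; exists d; intros [u v] [Hu _]; simpl.
      symmetry; apply is_derive_unique, Hd, Hu.
    + apply continuous_2d_iff, Hc'.
  - apply filter_forall; intros y; apply (ex_RInt_continuous (V := R_CompleteNormedModule)).
    intros; apply Hc.
Qed.

(** * Integrals over the sphere in polar angles *)

(** The measure is [dph dth] without the Jacobian [sin th]: with the Jacobian inside the integrand,
    a divergence on the sphere becomes a sum of plain derivatives in [th] and [ph]. *)
Definition angular_int (f : R -> R -> R) : R :=
  RInt (fun th => RInt (f th) 0 (2 * PI)) 0 PI.

Definition continuous2 (f : R -> R -> R) : Prop :=
  forall z, continuous (fun z => f (fst z) (snd z)) z.
Definition continuous3 {U : UniformSpace} (f : U -> R -> R -> R) : Prop :=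
  forall z, continuous (fun z => f (fst (fst z)) (snd (fst z)) (snd z)) z.

Lemma two_PI_ge_0 : 0 <= 2 * PI.
Proof. generalize PI_RGT_0; lra. Qed.

Lemma PI_ge_0 : 0 <= PI.
Proof. generalize PI_RGT_0; lra. Qed.

Lemma continuous3_apply {U : UniformSpace} (f : U -> R -> R -> R) (u : U) :
  continuous3 f -> continuous2 (f u).
Proof.
  intros Hf [t s].
  apply (continuous_comp (fun z : R * R => ((u, fst z), snd z))
    (fun z => f (fst (fst z)) (snd (fst z)) (snd z))); [|apply Hf].
  repeat apply continuous_pair; [apply continuous_const|apply continuous_fst|apply continuous_snd].
Qed.

Lemma continuous3_flip {U : UniformSpace} (f : U -> R -> R -> R) (t : R) :
  continuous3 f -> forall z, continuous (fun z => f (fst z) t (snd z)) z.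
Proof.
  intros Hf [u s].
  apply (continuous_comp (fun z : U * R => ((fst z, t), snd z))
    (fun z => f (fst (fst z)) (snd (fst z)) (snd z))); [|apply Hf].
  repeat apply continuous_pair; [apply continuous_fst|apply continuous_const|apply continuous_snd].
Qed.

Lemma continuous3_RInt {U : UniformSpace} (f : U -> R -> R -> R) :
  continuous3 f ->
  forall z, continuous (fun z => RInt (f (fst z) (snd z)) 0 (2 * PI)) z.
Proof.
  intros Hf z.
  apply (continuous_RInt_param (fun (z : U * R) ph => f (fst z) (snd z) ph)).
  apply two_PI_ge_0. exact Hf.
Qed.

Lemma continuous2_RInt (f : R -> R -> R) :
  continuous2 f -> forall t, continuous (fun t => RInt (f t) 0 (2 * PI)) t.
Proof. intros Hf; apply continuous_RInt_param; [apply two_PI_ge_0|exact Hf]. Qed.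

Lemma continuous_ex_RInt (f : R -> R) (a b : R) :
  (forall t, continuous f t) -> ex_RInt f a b.
Proof. intros; apply (ex_RInt_continuous (V := R_CompleteNormedModule)); auto. Qed.

Lemma continuous2_ex_RInt (f : R -> R -> R) (t a b : R) :
  continuous2 f -> ex_RInt (f t) a b.
Proof. intros Hf; apply continuous_ex_RInt; intros; apply continuous_slice, Hf. Qed.

Lemma angular_int_continuous {U : UniformSpace} (f : U -> R -> R -> R) (u : U) :
  continuous3 f -> continuous (fun u => angular_int (f u)) u.
Proof.
  intros Hf; unfold angular_int.
  apply (continuous_RInt_param (fun u th => RInt (f u th) 0 (2 * PI))).
  apply PI_ge_0. intros z; apply continuous3_RInt, Hf.
Qed.

(** Only continuity is asked globally; [f'] has to be the derivative of [f] just near [x]. This fits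
    the light cone, along which derivatives are known before it reaches the initial slice but not
    beyond. *)
Lemma angular_int_derive (f f' : R -> R -> R -> R) (x : R) :
  locally x (fun y => forall th ph, is_derive (fun r => f r th ph) y (f' y th ph)) ->
  continuous3 f -> continuous3 f' ->
  is_derive (fun r => angular_int (f r)) x (angular_int (f' x)).
Proof.
  intros Hd Hf Hf'; unfold angular_int.
  apply (is_derive_under_RInt (fun r th => RInt (f r th) 0 (2 * PI))
           (fun r th => RInt (f' r th) 0 (2 * PI))).
  - apply PI_ge_0.
  - generalize (locally_locally _ _ Hd); apply filter_imp; intros y Hy th.
    apply (is_derive_under_RInt (fun r ph => f r th ph) (fun r ph => f' r th ph)).
    + apply two_PI_ge_0.
    + revert Hy; apply filter_imp; auto.
    + intros r t; apply continuous_slice.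
      exact (continuous3_apply f r Hf (th, t)).
    + apply continuous3_flip, Hf'.
  - intros r t. apply continuous2_RInt, continuous3_apply, Hf.
  - apply continuous3_RInt, Hf'.
Qed.

Lemma angular_int_ext (f g : R -> R -> R) :
  (forall th ph, f th ph = g th ph) -> angular_int f = angular_int g.
Proof. intros H; apply RInt_ext; intros; apply RInt_ext; auto. Qed.

Lemma angular_int_plus (f g : R -> R -> R) :
  continuous2 f -> continuous2 g ->
  angular_int (fun th ph => f th ph + g th ph) = angular_int f + angular_int g.
Proof.
  intros Hf Hg; unfold angular_int.
  rewrite <- (RInt_plus (V := R_CompleteNormedModule))
    by (apply continuous_ex_RInt, continuous2_RInt; assumption).
  apply RInt_ext; intros th _.
  apply (RInt_plus (V := R_CompleteNormedModule)); apply continuous2_ex_RInt; assumption.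
Qed.

Lemma angular_int_opp (f : R -> R -> R) :
  continuous2 f -> angular_int (fun th ph => - f th ph) = - angular_int f.
Proof.
  intros Hf; unfold angular_int.
  rewrite <- (RInt_opp (V := R_CompleteNormedModule))
    by (apply continuous_ex_RInt, continuous2_RInt; assumption).
  apply RInt_ext; intros th _.
  apply (RInt_opp (V := R_CompleteNormedModule)); apply continuous2_ex_RInt; assumption.
Qed.

Lemma RInt_derivative (f f' : R -> R) (a b : R) :
  (forall t, is_derive f t (f' t)) -> (forall t, continuous f' t) ->
  RInt f' a b = f b - f a.
Proof.
  intros Hd Hc; apply is_RInt_unique.
  apply (is_RInt_derive (V := R_CompleteNormedModule)); auto.
Qed.

(** Differentiating under the inner integral exhibits a primitive in [th], whose boundary values are
    integrals over the two poles. *)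
Lemma angular_int_dtheta (f f' : R -> R -> R) :
  (forall th ph, is_derive (fun t => f t ph) th (f' th ph)) ->
  continuous2 f -> continuous2 f' ->
  (forall ph, f 0 ph = 0) -> (forall ph, f PI ph = 0) ->
  angular_int f' = 0.
Proof.
  intros Hd Hf Hf' H0 H1; unfold angular_int.
  rewrite (RInt_derivative (fun th => RInt (f th) 0 (2 * PI))).
  - rewrite (RInt_ext (f 0) (fun _ => 0)) by auto.
    rewrite (RInt_ext (f PI) (fun _ => 0)) by auto. ring.
  - intros th; apply is_derive_under_RInt.
    + apply two_PI_ge_0.
    + apply filter_forall; auto.
    + intros y t; apply continuous_slice, Hf.
    + exact Hf'.
  - apply continuous2_RInt, Hf'.
Qed.

Lemma angular_int_dphi (f f' : R -> R -> R) :
  (forall th ph, is_derive (f th) ph (f' th ph)) ->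
  continuous2 f' ->
  (forall th, f th (2 * PI) = f th 0) ->
  angular_int f' = 0.
Proof.
  intros Hd Hf' H0; unfold angular_int.
  rewrite (RInt_ext _ (fun _ => 0)).
  - rewrite RInt_const; apply Rmult_0_r.
  - intros th _. rewrite (RInt_derivative (f th)); [rewrite H0; apply Rminus_diag_eq; reflexivity|auto|].
    intros t; apply continuous_slice, Hf'.
Qed.

Lemma angular_int_theta (f : R -> R) :
  (forall t, continuous f t) ->
  angular_int (fun th _ => f th) = 2 * PI * RInt f 0 PI.
Proof.
  intros Hf; unfold angular_int.
  rewrite (RInt_ext _ (fun th => scal (2 * PI) (f th))).
  - apply (RInt_scal (V := R_CompleteNormedModule)), continuous_ex_RInt, Hf.
  - intros th _; rewrite RInt_const; f_equal; ring.
Qed.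

Lemma angular_int_abs_le (f : R -> R -> R) (g : R -> R) :
  continuous2 f -> (forall t, continuous g t) ->
  (forall th ph, 0 <= th <= PI -> Rabs (f th ph) <= g th) ->
  Rabs (angular_int f) <= 2 * PI * RInt g 0 PI.
Proof.
  intros Hf Hg Hle; rewrite <- angular_int_theta by assumption; unfold angular_int.
  apply Rle_trans with (RInt (fun th => Rabs (RInt (f th) 0 (2 * PI))) 0 PI).
  - apply abs_RInt_le; [apply PI_ge_0|apply continuous_ex_RInt, continuous2_RInt, Hf].
  - apply RInt_le; [apply PI_ge_0| | |].
    + apply continuous_ex_RInt; intros t; apply continuous_Rabs_comp.
      apply continuous2_RInt, Hf.
    + apply continuous_ex_RInt; intros t.
      apply continuous_ext with (fun t => 2 * PI * g t).
      * intros y; rewrite RInt_const; unfold scal; simpl; unfold mult; simpl; ring.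
      * apply (continuous_mult (K := R_AbsRing)); [apply continuous_const|apply Hg].
    + intros th Hth.
      apply Rle_trans with ((2 * PI - 0) * g th).
      * apply abs_RInt_le_const; [apply two_PI_ge_0|apply continuous2_ex_RInt, Hf|].
        intros ph _; apply Hle; lra.
      * rewrite RInt_const; apply Rle_refl.
Qed.

(** * Kirchhoff's formula *)

Definition vec := axis -> R.

(** The spherical moving frame attached to [(a, b, c)]: the [th]-derivative of [omega] is [e_theta],
    its [ph]-derivative is [sin th * e_phi], and [e_phi] has [ph]-derivative [- horizontal]. *)
Definition horizontal (a b : vec) (ph : R) : vec :=
  fun i => cos ph * a i + sin ph * b i.
Definition e_phi (a b : vec) (ph : R) : vec :=
  fun i => - sin ph * a i + cos ph * b i.
Definition omega (a b c : vec) (th ph : R) : vec :=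
  fun i => sin th * horizontal a b ph i + cos th * c i.
Definition e_theta (a b c : vec) (th ph : R) : vec :=
  fun i => cos th * horizontal a b ph i - sin th * c i.

Definition dot_grad (v : vec) (D : axis -> event -> R) (p : event) : R :=
  v ax1 * D ax1 p + v ax2 * D ax2 p + v ax3 * D ax3 p.

Definition hess (v w : vec) (D2 : axis -> axis -> event -> R) (p : event) : R :=
  v ax1 * dot_grad w (fun i => D2 i ax1) p
  + v ax2 * dot_grad w (fun i => D2 i ax2) p
  + v ax3 * dot_grad w (fun i => D2 i ax3) p.

(** Orthonormality in the form of the completeness relation [a a^t + b b^t + c c^t = 1], because it
    serves to turn the trace of the Hessian in a frame into the Cartesian Laplacian. *)
Definition orthonormal_frame (a b c : vec) : Prop :=
  forall i j, i <> axT -> j <> axT ->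
    (i = j -> a i * a j + b i * b j + c i * c j = 1) /\
    (i <> j -> a i * a j + b i * b j + c i * c j = 0).

(** The point in direction [omega] on the backward light cone with apex [(T, X)]; fixed [r] gives a
    sphere in the slice at time [T - r]. *)
Definition cone (T : R) (X : space) (a b c : vec) (r th ph : R) : event :=
  let '(x1, x2, x3) := X in
  (T - r, (x1 + r * omega a b c th ph ax1,
           x2 + r * omega a b c th ph ax2,
           x3 + r * omega a b c th ph ax3)).

(** [D2 i j] stands for the [i]-derivative of [D j]. Continuity holds everywhere, the differential
    relations only for positive time, so one-sided derivatives at [T = 0] never have to be
    differentiated or composed. *)
Definition jet2 (u : event -> R) (D : axis -> event -> R) (D2 : axis -> axis -> event -> R) : Prop :=
  (forall p, continuous u p) /\ (forall i p, continuous (D i) p) /\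
  (forall i j p, continuous (D2 i j) p) /\
  (forall p, 0 < fst p -> has_partials u D p) /\
  (forall j p, 0 < fst p -> has_partials (D j) (fun i => D2 i j) p) /\
  (forall i j p, 0 < fst p -> D2 i j p = D2 j i p).

Lemma locally_future (p : event) : 0 < fst p -> locally p (fun q => 0 < fst q).
Proof.
  intros Hp.
  apply (continuous_fst (U := R_UniformSpace) (fst p) (snd p) (fun t => 0 < t)).
  apply (open_gt 0); exact Hp.
Qed.

Lemma is_derive_Rmult (f g : R -> R) (x l m : R) :
  is_derive f x l -> is_derive g x m -> is_derive (fun t => f t * g t) x (l * g x + f x * m).
Proof. intros; apply (is_derive_mult (K := R_AbsRing)); auto; intros; apply Rmult_comm. Qed.

Lemma is_derive_Rplus (f g : R -> R) (x l m : R) :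
  is_derive f x l -> is_derive g x m -> is_derive (fun t => f t + g t) x (l + m).
Proof. intros; apply (is_derive_plus (V := R_NormedModule)); auto. Qed.

Lemma is_derive_eq (f : R -> R) (x l m : R) : is_derive f x l -> l = m -> is_derive f x m.
Proof. intros H <-; exact H. Qed.

(** * Derivatives along the backward light cone *)

Section Cone.
Context (T : R) (X : space) (a b c : vec).

Lemma cone_derive_r (f : event -> R) (D : axis -> event -> R) (r th ph : R) :
  (forall p, 0 < fst p -> has_partials f D p) -> (forall i p, continuous (D i) p) ->
  r < T ->
  is_derive (fun r => f (cone T X a b c r th ph)) r
    (- D axT (cone T X a b c r th ph) + dot_grad (omega a b c th ph) D (cone T X a b c r th ph)).
Proof.
  intros Hd Hc Hr; destruct X as [[x1 x2] x3]; simpl.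
  eapply is_derive_eq.
  - apply (is_derive_curve f D (fun r => T - r)
      (fun r => x1 + r * omega a b c th ph ax1) (fun r => x2 + r * omega a b c th ph ax2)
      (fun r => x3 + r * omega a b c th ph ax3) (-1)
      (omega a b c th ph ax1) (omega a b c th ph ax2) (omega a b c th ph ax3) r); auto.
    + eapply filter_imp; [apply Hd|apply locally_future; simpl; lra].
    + auto_derive; [exact I|ring].
    + auto_derive; [exact I|ring].
    + auto_derive; [exact I|ring].
    + auto_derive; [exact I|ring].
  - unfold dot_grad; ring.
Qed.

Lemma cone_derive_theta (f : event -> R) (D : axis -> event -> R) (r th ph : R) :
  (forall p, 0 < fst p -> has_partials f D p) -> (forall i p, continuous (D i) p) ->
  r < T ->
  is_derive (fun th => f (cone T X a b c r th ph)) th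
    (r * dot_grad (e_theta a b c th ph) D (cone T X a b c r th ph)).
Proof.
  intros Hd Hc Hr; destruct X as [[x1 x2] x3]; simpl.
  eapply is_derive_eq.
  - apply (is_derive_curve f D (fun th => T - r)
      (fun th => x1 + r * omega a b c th ph ax1) (fun th => x2 + r * omega a b c th ph ax2)
      (fun th => x3 + r * omega a b c th ph ax3) 0
      (r * e_theta a b c th ph ax1) (r * e_theta a b c th ph ax2) (r * e_theta a b c th ph ax3) th); auto.
    + eapply filter_imp; [apply Hd|apply locally_future; simpl; lra].
    + auto_derive; [exact I|ring].
    + unfold omega, e_theta; auto_derive; [exact I|ring].
    + unfold omega, e_theta; auto_derive; [exact I|ring].
    + unfold omega, e_theta; auto_derive; [exact I|ring].
  - unfold dot_grad; ring.
Qed.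

Lemma cone_derive_phi (f : event -> R) (D : axis -> event -> R) (r th ph : R) :
  (forall p, 0 < fst p -> has_partials f D p) -> (forall i p, continuous (D i) p) ->
  r < T ->
  is_derive (fun ph => f (cone T X a b c r th ph)) ph
    (r * sin th * dot_grad (e_phi a b ph) D (cone T X a b c r th ph)).
Proof.
  intros Hd Hc Hr; destruct X as [[x1 x2] x3]; simpl.
  eapply is_derive_eq.
  - apply (is_derive_curve f D (fun ph => T - r)
      (fun ph => x1 + r * omega a b c th ph ax1) (fun ph => x2 + r * omega a b c th ph ax2)
      (fun ph => x3 + r * omega a b c th ph ax3) 0
      (r * sin th * e_phi a b ph ax1) (r * sin th * e_phi a b ph ax2) (r * sin th * e_phi a b ph ax3) ph); auto.
    + eapply filter_imp; [apply Hd|apply locally_future; simpl; lra].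
    + auto_derive; [exact I|ring].
    + unfold omega, e_phi, horizontal; auto_derive; [exact I|ring].
    + unfold omega, e_phi, horizontal; auto_derive; [exact I|ring].
    + unfold omega, e_phi, horizontal; auto_derive; [exact I|ring].
  - unfold dot_grad; ring.
Qed.
End Cone.

Lemma is_derive_dot_grad (v : R -> vec) (v' : vec) (D : axis -> event -> R) (P : R -> event)
    (dD : axis -> R) (s : R) :
  (forall i, is_derive (fun t => v t i) s (v' i)) ->
  (forall i, is_derive (fun t => D i (P t)) s (dD i)) ->
  is_derive (fun t => dot_grad (v t) D (P t)) s
    (dot_grad v' D (P s) + (v s ax1 * dD ax1 + v s ax2 * dD ax2 + v s ax3 * dD ax3)).
Proof.
  intros Hv HD. eapply is_derive_eq.
  - unfold dot_grad.
    apply is_derive_Rplus; [apply is_derive_Rplus|]; apply is_derive_Rmult; auto.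
  - unfold dot_grad; ring.
Qed.

(** * Continuity of frames, cones and gradients *)

Lemma continuous_Rcomp {U : UniformSpace} (g : R -> R) (f : U -> R) (x : U) :
  (forall y, continuous g y) -> continuous f x -> continuous (fun t => g (f t)) x.
Proof. intros Hg Hf; apply continuous_comp; auto. Qed.

Ltac continuity_tac :=
  cbv beta;
  lazymatch goal with
  | |- continuous _ _ => first [assumption | solve [auto] | continuity_step]
  | _ => idtac
  end
with continuity_step :=
  lazymatch goal with
  | |- continuous (fun _ => ?k) _ => apply continuous_const
  | |- continuous (fun w => w) _ => apply continuous_id
  | |- continuous (fun w => @?f w + @?g w) _ =>
      apply (continuous_plus (V := R_NormedModule) f g); continuity_tac
  | |- continuous (fun w => @?f w - @?g w) _ =>
      apply (continuous_minus (V := R_NormedModule) f g); continuity_tac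
  | |- continuous (fun w => @?f w * @?g w) _ =>
      apply (continuous_mult (K := R_AbsRing) f g); continuity_tac
  | |- continuous (fun w => - @?f w) _ =>
      apply (continuous_opp (V := R_NormedModule) f); continuity_tac
  | |- continuous (fun w => cos (@?f w)) _ =>
      apply (continuous_Rcomp cos f); [exact continuous_cos|continuity_tac]
  | |- continuous (fun w => sin (@?f w)) _ =>
      apply (continuous_Rcomp sin f); [exact continuous_sin|continuity_tac]
  | _ => idtac
  end.

Lemma continuous_frame {U : UniformSpace} (a b c : vec) (th ph : U -> R) (w : U) (i : axis) :
  continuous th w -> continuous ph w ->
  continuous (fun w => omega a b c (th w) (ph w) i) w /\
  continuous (fun w => e_theta a b c (th w) (ph w) i) w /\
  continuous (fun w => e_phi a b (ph w) i) w /\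
  continuous (fun w => horizontal a b (ph w) i) w.
Proof.
  intros Ht Hp; unfold omega, e_theta, e_phi, horizontal; repeat split; continuity_tac.
Qed.

Lemma continuous_cone {U : UniformSpace} (T : R) (X : space) (a b c : vec)
    (r th ph : U -> R) (w : U) :
  continuous r w -> continuous th w -> continuous ph w ->
  continuous (fun w => cone T X a b c (r w) (th w) (ph w)) w.
Proof.
  intros Hr Ht Hp; destruct X as [[x1 x2] x3].
  assert (H := fun i => proj1 (continuous_frame a b c th ph w i Ht Hp)).
  unfold cone; apply continuous_event; continuity_tac.
Qed.

Lemma continuous_dot_grad {U : UniformSpace} (v : U -> vec) (D : axis -> event -> R)
    (P : U -> event) (w : U) :
  (forall i, continuous (fun w => v w i) w) -> (forall i p, continuous (D i) p) ->
  continuous P w -> continuous (fun w => dot_grad (v w) D (P w)) w.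
Proof.
  intros Hv HD HP.
  assert (H : forall i, continuous (fun w => D i (P w)) w)
    by (intros i; apply (continuous_comp P (D i)); auto).
  unfold dot_grad; continuity_tac.
Qed.

Lemma continuous_hess {U : UniformSpace} (v v' : U -> vec) (D2 : axis -> axis -> event -> R)
    (P : U -> event) (w : U) :
  (forall i, continuous (fun w => v w i) w) -> (forall i, continuous (fun w => v' w i) w) ->
  (forall i j p, continuous (D2 i j) p) ->
  continuous P w -> continuous (fun w => hess (v w) (v' w) D2 (P w)) w.
Proof.
  intros Hv Hv' HD HP.
  assert (H : forall j, continuous (fun w => dot_grad (v' w) (fun i => D2 i j) (P w)) w)
    by (intros j; apply continuous_dot_grad; auto).
  unfold hess; continuity_tac.
Qed.

(** * The divergence identity on the sphere *)

Section Kirchhoff.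
Context (u : event -> R) (D : axis -> event -> R) (D2 : axis -> axis -> event -> R).
Context (T : R) (X : space) (a b c : vec).

Let P := cone T X a b c.
Let om := omega a b c.
Let e := e_theta a b c.
Let n := e_phi a b.

Definition cone_flux (r th ph : R) : R :=
  sin th * (u (P r th ph) + r * (D axT (P r th ph) + dot_grad (om th ph) D (P r th ph))).

Let flux' (r th ph : R) : R :=
  sin th * (2 * dot_grad (om th ph) D (P r th ph)
    + r * (hess (om th ph) (om th ph) D2 (P r th ph) - D2 axT axT (P r th ph))).

(* [A] and [B] are the components along [e_theta] and [e_phi] of the gradient, weighted so that
   [flux' + A' + B' = r * sin th * box u] has no singularity at the poles. *)
Let A (r th ph : R) : R := sin th * dot_grad (e th ph) D (P r th ph).
Let A' (r th ph : R) : R :=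
  cos th * dot_grad (e th ph) D (P r th ph)
  + sin th * (r * hess (e th ph) (e th ph) D2 (P r th ph) - dot_grad (om th ph) D (P r th ph)).
Let B (r th ph : R) : R := dot_grad (n ph) D (P r th ph).
Let B' (r th ph : R) : R :=
  r * sin th * hess (n ph) (n ph) D2 (P r th ph)
  - dot_grad (horizontal a b ph) D (P r th ph).

Context (Hjet : jet2 u D D2).
Context (Hframe : orthonormal_frame a b c).
Context (Hwave : forall p, 0 < fst p ->
  D2 axT axT p = D2 ax1 ax1 p + D2 ax2 ax2 p + D2 ax3 ax3 p).

(** Along the cone the [r]-derivative is [- d_T + omega . grad]. The [- u_T] coming from [u] cancels
    the [u_T] coming from the product rule, and the mixed derivatives [omega . grad u_T] cancel by
    symmetry of [D2]. *)
Lemma flux_derive (r th ph : R) : r < T ->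
  is_derive (fun r => cone_flux r th ph) r (flux' r th ph).
Proof.
  destruct Hjet as (cu & cD & cD2 & du & dD & sym); intros Hr.
  unfold cone_flux.
  eapply is_derive_eq.
  - apply (is_derive_Rmult (fun _ => sin th)); [apply (is_derive_const (V := R_NormedModule))|].
    apply is_derive_Rplus; [apply cone_derive_r with (D := D); auto|].
    apply (is_derive_Rmult (fun r => r)); [apply (is_derive_id (K := R_AbsRing))|].
    apply is_derive_Rplus; [apply cone_derive_r with (D := fun i => D2 i axT); auto|].
    apply (is_derive_dot_grad (fun _ => om th ph) (fun _ => 0) D (fun r => P r th ph)
      (fun i => - D2 axT i (P r th ph) + dot_grad (om th ph) (fun j => D2 j i) (P r th ph))).
    + intros; apply (is_derive_const (V := R_NormedModule)).
    + intros i; apply cone_derive_r with (D := fun j => D2 j i); auto.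
  - assert (Hp : 0 < fst (P r th ph)) by (unfold P, cone; destruct X as [[? ?] ?]; simpl; lra).
    unfold flux', hess, dot_grad; fold P; fold om.
    change (@one R_AbsRing) with 1; change (@zero R_NormedModule) with 0.
    rewrite (sym axT ax1 _ Hp), (sym axT ax2 _ Hp), (sym axT ax3 _ Hp). ring.
Qed.

Lemma A_derive (r th ph : R) : r < T -> is_derive (fun th => A r th ph) th (A' r th ph).
Proof.
  destruct Hjet as (cu & cD & cD2 & du & dD & sym); intros Hr.
  unfold A. eapply is_derive_eq.
  - apply is_derive_Rmult; [apply is_derive_sin|].
    apply (is_derive_dot_grad (fun th => e th ph) (fun i => - om th ph i) D (fun th => P r th ph)
      (fun i => r * dot_grad (e th ph) (fun j => D2 j i) (P r th ph))).
    + intros; unfold e, om, e_theta, omega; auto_derive; [exact I|ring].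
    + intros i; apply cone_derive_theta with (D := fun j => D2 j i); auto.
  - unfold A', hess, dot_grad. ring.
Qed.

Lemma B_derive (r th ph : R) : r < T -> is_derive (B r th) ph (B' r th ph).
Proof.
  destruct Hjet as (cu & cD & cD2 & du & dD & sym); intros Hr.
  unfold B. eapply is_derive_eq.
  - apply (is_derive_dot_grad n (fun i => - horizontal a b ph i) D (fun ph => P r th ph)
      (fun i => r * sin th * dot_grad (n ph) (fun j => D2 j i) (P r th ph))).
    + intros; unfold n, e_phi, horizontal; auto_derive; [exact I|ring].
    + intros i; apply cone_derive_phi with (D := fun j => D2 j i); auto.
  - unfold B', hess, dot_grad. ring.
Qed.

(** The moving frame arises from [(a, b, c)] by an orthogonal transformation, so it inherits the
    completeness relation. *)
Lemma frame_complete (th ph : R) (i j : axis) : i <> axT -> j <> axT ->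
  (i = j -> om th ph i * om th ph j + e th ph i * e th ph j + n ph i * n ph j = 1) /\
  (i <> j -> om th ph i * om th ph j + e th ph i * e th ph j + n ph i * n ph j = 0).
Proof.
  intros Hi Hj; destruct (Hframe i j Hi Hj) as [F1 F0].
  assert (E : om th ph i * om th ph j + e th ph i * e th ph j + n ph i * n ph j
    = a i * a j + b i * b j + c i * c j).
  { generalize (sin2_cos2 th) (sin2_cos2 ph); unfold Rsqr; intros St Sp.
    unfold om, e, n, omega, e_theta, e_phi.
    transitivity ((sin th * sin th + cos th * cos th) * (horizontal a b ph i * horizontal a b ph j + c i * c j)
      + (- sin ph * a i + cos ph * b i) * (- sin ph * a j + cos ph * b j)); [ring|].
    rewrite St; unfold horizontal.
    transitivity ((sin ph * sin ph + cos ph * cos ph) * (a i * a j + b i * b j) + c i * c j); [ring|].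
    rewrite Sp; ring. }
  rewrite E; split; assumption.
Qed.

(** The first-order terms cancel because [horizontal = sin th * omega + cos th * e_theta]. The
    second-order ones add up to [r * sin th] times the trace of the Hessian in the moving frame
    minus [u_TT], which vanishes by completeness and the wave equation. *)
Lemma divergence_identity (r th ph : R) : r < T ->
  flux' r th ph = - (A' r th ph + B' r th ph).
Proof.
  destruct Hjet as (cu & cD & cD2 & du & dD & sym); intros Hr.
  assert (Hp : 0 < fst (P r th ph)) by (unfold P, cone; destruct X as [[? ?] ?]; simpl; lra).
  assert (Hm : forall i, horizontal a b ph i = sin th * om th ph i + cos th * e th ph i).
  { intros i; unfold om, e, omega, e_theta.
    generalize (sin2_cos2 th); unfold Rsqr; intros St.
    transitivity ((sin th * sin th + cos th * cos th) * horizontal a b ph i); [rewrite St|]; ring. }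
  unfold flux', A', B', hess, dot_grad.
  rewrite (Hwave _ Hp), (sym ax2 ax1 _ Hp), (sym ax3 ax1 _ Hp), (sym ax3 ax2 _ Hp), !Hm.
  assert (F := frame_complete th ph).
  assert (F11 := proj1 (F ax1 ax1 ltac:(discriminate) ltac:(discriminate)) eq_refl).
  assert (F22 := proj1 (F ax2 ax2 ltac:(discriminate) ltac:(discriminate)) eq_refl).
  assert (F33 := proj1 (F ax3 ax3 ltac:(discriminate) ltac:(discriminate)) eq_refl).
  assert (F12 := proj2 (F ax1 ax2 ltac:(discriminate) ltac:(discriminate)) ltac:(discriminate)).
  assert (F13 := proj2 (F ax1 ax3 ltac:(discriminate) ltac:(discriminate)) ltac:(discriminate)).
  assert (F23 := proj2 (F ax2 ax3 ltac:(discriminate) ltac:(discriminate)) ltac:(discriminate)).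
  clear F Hm.
  revert F11 F22 F33 F12 F13 F23.
  generalize (om th ph ax1), (om th ph ax2), (om th ph ax3),
    (e th ph ax1), (e th ph ax2), (e th ph ax3), (n ph ax1), (n ph ax2), (n ph ax3), (P r th ph).
  intros o1 o2 o3 e1 e2 e3 n1 n2 n3 p F11 F22 F33 F12 F13 F23.
  apply Rminus_diag_uniq.
  (* Collected by entries of the Hessian, each coefficient is the defect of one completeness
     relation. *)
  transitivity (r * sin th * (
    D2 ax1 ax1 p * (o1 * o1 + e1 * e1 + n1 * n1 - 1)
    + D2 ax2 ax2 p * (o2 * o2 + e2 * e2 + n2 * n2 - 1)
    + D2 ax3 ax3 p * (o3 * o3 + e3 * e3 + n3 * n3 - 1)
    + 2 * D2 ax1 ax2 p * (o1 * o2 + e1 * e2 + n1 * n2)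
    + 2 * D2 ax1 ax3 p * (o1 * o3 + e1 * e3 + n1 * n3)
    + 2 * D2 ax2 ax3 p * (o2 * o3 + e2 * e3 + n2 * n3))); [ring|].
  rewrite F11, F22, F33, F12, F13, F23; ring.
Qed.


Lemma coordinates_continuous (z : R * R * R) :
  continuous (fun z : R * R * R => fst (fst z)) z /\
  continuous (fun z : R * R * R => snd (fst z)) z /\
  continuous (fun z : R * R * R => snd z) z.
Proof.
  repeat split.
  - apply (continuous_comp (fst : R * R * R -> R * R) fst); apply continuous_fst.
  - apply (continuous_comp (fst : R * R * R -> R * R) snd); [apply continuous_fst|apply continuous_snd].
  - apply continuous_snd.
Qed.

Lemma integrands_continuous :
  continuous3 cone_flux /\ continuous3 flux' /\ continuous3 A /\ continuous3 A' /\ continuous3 B'.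
Proof.
  destruct Hjet as (cu & cD & cD2 & _).
  assert (H : forall z : R * R * R,
    let r := fun z : R * R * R => fst (fst z) in
    let th := fun z : R * R * R => snd (fst z) in
    let ph := fun z : R * R * R => snd z in
    continuous (fun z => cone_flux (r z) (th z) (ph z)) z /\
    continuous (fun z => flux' (r z) (th z) (ph z)) z /\
    continuous (fun z => A (r z) (th z) (ph z)) z /\
    continuous (fun z => A' (r z) (th z) (ph z)) z /\
    continuous (fun z => B' (r z) (th z) (ph z)) z).
  { intros z r th ph; destruct (coordinates_continuous z) as (cr & ct & cp).
    change (continuous r z) in cr; change (continuous th z) in ct; change (continuous ph z) in cp.
    clearbody r th ph.
    assert (CP := continuous_cone T X a b c r th ph z cr ct cp).
    assert (CF := fun i => continuous_frame a b c th ph z i ct cp).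
    assert (Co := fun i => proj1 (CF i)).
    assert (Ce := fun i => proj1 (proj2 (CF i))).
    assert (Cn := fun i => proj1 (proj2 (proj2 (CF i)))).
    assert (Cm := fun i => proj2 (proj2 (proj2 (CF i)))).
    assert (Cu := continuous_comp _ u z CP (cu _)).
    assert (CT := continuous_comp _ (D axT) z CP (cD _ _)).
    assert (CTT := continuous_comp _ (D2 axT axT) z CP (cD2 _ _ _)).
    assert (Go := continuous_dot_grad _ D _ z Co cD CP).
    assert (Ge := continuous_dot_grad _ D _ z Ce cD CP).
    assert (Gm := continuous_dot_grad _ D _ z Cm cD CP).
    assert (Hoo := continuous_hess _ _ D2 _ z Co Co cD2 CP).
    assert (Hee := continuous_hess _ _ D2 _ z Ce Ce cD2 CP).
    assert (Hnn := continuous_hess _ _ D2 _ z Cn Cn cD2 CP).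
    unfold cone_flux, flux', A, A', B', P, om, e, n.
    repeat split; continuity_tac. }
  repeat split; intros z; apply (H z).
Qed.

Lemma cone_flux_stationary (r : R) : r < T ->
  is_derive (fun r => angular_int (cone_flux r)) r 0.
Proof.
  intros Hr.
  destruct integrands_continuous as (C1 & C2 & C3 & C4 & C5).
  assert (C4' := continuous3_apply A' r C4).
  assert (C5' := continuous3_apply B' r C5).
  apply is_derive_eq with (angular_int (flux' r)).
  - apply angular_int_derive; auto.
    apply filter_imp with (fun y => y < T); [|apply (open_lt T); exact Hr].
    intros; apply flux_derive; assumption.
  - rewrite (angular_int_ext _ (fun th ph => - (A' r th ph + B' r th ph)))
      by (intros; apply divergence_identity; assumption).
    rewrite (angular_int_opp (fun th ph => A' r th ph + B' r th ph)), angular_int_plus; auto.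
    + rewrite (angular_int_dtheta (A r) (A' r)), (angular_int_dphi (B r) (B' r)); auto.
      * ring.
      * intros; apply B_derive; assumption.
      * intros th; unfold B, n, e_phi, P, cone, omega, horizontal.
        rewrite sin_2PI, cos_2PI, sin_0, cos_0; reflexivity.
      * intros; apply A_derive; assumption.
      * apply continuous3_apply, C3.
      * intros; unfold A; rewrite sin_0; ring.
      * intros; unfold A; rewrite sin_PI; ring.
    + intros z; apply (continuous_plus (V := R_NormedModule)
        (fun z => A' r (fst z) (snd z)) (fun z => B' r (fst z) (snd z))); auto.
Qed.

Lemma cone_flux_tip : angular_int (cone_flux 0) = 4 * PI * u (T, X).
Proof.
  rewrite (angular_int_ext _ (fun th _ => u (T, X) * sin th)).
  - rewrite (angular_int_theta (fun th => u (T, X) * sin th)).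
    + rewrite (RInt_derivative (fun th => - u (T, X) * cos th)).
      * rewrite cos_PI, cos_0; ring.
      * intros; auto_derive; [exact I|ring].
      * intros; continuity_tac.
    + intros; continuity_tac.
  - intros th ph; unfold cone_flux, P, cone; destruct X as [[x1 x2] x3].
    rewrite !Rmult_0_l, !Rplus_0_r, Rminus_0_r; apply Rmult_comm.
Qed.

(** The mean value theorem asks for the derivative on the open interval and for continuity at its
    ends. This is exactly what is available at [r = T], where the cone meets the initial slice. *)
Theorem kirchhoff : 0 <= T -> 4 * PI * u (T, X) = angular_int (cone_flux T).
Proof.
  intros HT; rewrite <- cone_flux_tip.
  destruct (MVT_gen (fun r => angular_int (cone_flux r)) 0 T (fun _ => 0)) as (x & _ & Hx).
  - rewrite Rmin_left, Rmax_right by assumption.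
    intros; apply cone_flux_stationary; lra.
  - intros; apply continuity_pt_filterlim.
    apply (angular_int_continuous cone_flux); apply integrands_continuous.
  - lra.
Qed.
End Kirchhoff.

(** * Decay of waves with compactly supported data *)

Definition dot (v w : vec) : R := v ax1 * w ax1 + v ax2 * w ax2 + v ax3 * w ax3.

Definition mkvec (x1 x2 x3 : R) : vec :=
  fun i => match i with axT => 0 | ax1 => x1 | ax2 => x2 | ax3 => x3 end.

Lemma radius_sqr (x1 x2 x3 : R) : radius (x1, x2, x3) ^ 2 = x1 ^ 2 + x2 ^ 2 + x3 ^ 2.
Proof. simpl radius; rewrite pow2_sqrt; [reflexivity|nra]. Qed.

Lemma radius_ge_0 (X : space) : 0 <= radius X.
Proof. destruct X as [[x1 x2] x3]; apply sqrt_pos. Qed.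

Lemma radius_gt_0 (X : space) : X <> (0, 0, 0) -> 0 < radius X.
Proof.
  destruct X as [[x1 x2] x3]; intros H.
  destruct (radius_ge_0 (x1, x2, x3)) as [|E]; [assumption|].
  exfalso; apply H.
  generalize (radius_sqr x1 x2 x3); rewrite <- E; intros.
  repeat f_equal; nra.
Qed.

(* The Householder reflection exchanging (0,0,1) and the unit vector c. *)
Lemma frame_of_axis (c1 c2 c3 : R) : c1 ^ 2 + c2 ^ 2 + c3 ^ 2 = 1 ->
  exists a b : vec, let c := mkvec c1 c2 c3 in
    orthonormal_frame a b c /\
    dot a a = 1 /\ dot b b = 1 /\ dot c c = 1 /\ dot a b = 0 /\ dot a c = 0 /\ dot b c = 0.
Proof.
  (* The reflection is along [c - (0,0,1)], of squared length [2 * (1 - c3)]; it degenerates at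
     [c3 = 1], where the standard basis serves. *)
  intros Hc. destruct (Req_dec c3 1) as [->|H3].
  - assert (c1 = 0) by nra; assert (c2 = 0) by nra; subst.
    exists (mkvec 1 0 0), (mkvec 0 1 0); cbv zeta; split.
    + intros i j Hi Hj; destruct i, j; split; try congruence; intros _; simpl; ring.
    + unfold dot; simpl; repeat split; ring.
  - set (k := / (1 - c3)).
    assert (Hk : k * (1 - c3) = 1) by (unfold k; field; lra).
    clearbody k; assert (Hc' : c1 * c1 + c2 * c2 + c3 * c3 = 1) by nra; clear Hc H3.
    exists (mkvec (1 - k * (c1 * c1)) (- k * c1 * c2) c1), (mkvec (- k * c1 * c2) (1 - k * (c2 * c2)) c2).
    cbv zeta; split.
    + intros i j Hi Hj; destruct i, j; split; try congruence; intros _; simpl; nsatz.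
    + unfold dot; simpl; repeat split; nsatz.
Qed.

(** Orthonormality is delivered twice: the completeness relation feeds Kirchhoff's formula, the
    pairwise products feed the law of cosines on the sphere around [X]. *)
Lemma frame_at (X : space) : exists a b c : vec,
  let R := radius X in
  X = (- R * c ax1, - R * c ax2, - R * c ax3) /\
  orthonormal_frame a b c /\
  dot a a = 1 /\ dot b b = 1 /\ dot c c = 1 /\ dot a b = 0 /\ dot a c = 0 /\ dot b c = 0.
Proof.
  destruct X as [[x1 x2] x3]; set (r := radius (x1, x2, x3)).
  assert (Hr := radius_sqr x1 x2 x3); fold r in Hr.
  assert (Hr0 := radius_ge_0 (x1, x2, x3)); fold r in Hr0.
  destruct Hr0 as [Hr0|Hr0].
  - destruct (frame_of_axis (- x1 / r) (- x2 / r) (- x3 / r)) as (a & b & H).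
    + transitivity ((x1 ^ 2 + x2 ^ 2 + x3 ^ 2) / r ^ 2); [field; lra|].
      rewrite <- Hr; field; lra.
    + exists a, b, (mkvec (- x1 / r) (- x2 / r) (- x3 / r)); cbv zeta; split; [|exact H].
      simpl; repeat f_equal; field; lra.
  (* At [X = 0] the direction towards the origin is undefined and any polar axis will do. *)
  - destruct (frame_of_axis 0 0 1) as (a & b & H); [ring|].
    exists a, b, (mkvec 0 0 1); cbv zeta; split; [|exact H].
    rewrite <- Hr0 in *; repeat f_equal; nra.
Qed.

(** * Integral bounds for the full sphere and for a cap *)

Lemma Rabs_Rmult_le (x y p q : R) : Rabs x <= p -> Rabs y <= q -> Rabs (x * y) <= p * q.
Proof.
  intros; rewrite Rabs_mult; apply Rmult_le_compat; auto using Rabs_pos.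
Qed.

Lemma Rabs_Rplus_le (x y p q : R) : Rabs x <= p -> Rabs y <= q -> Rabs (x + y) <= p + q.
Proof.
  intros; eapply Rle_trans; [apply Rabs_triang|]; lra.
Qed.

Lemma RInt_sin_0_PI : RInt sin 0 PI = 2.
Proof.
  rewrite (RInt_derivative (fun th => - cos th)).
  - rewrite cos_PI, cos_0. change (- -1 - - 1 = 2 :> R). ring.
  - intros; auto_derive; [exact I|ring].
  - apply continuous_sin.
Qed.

(* The factor of [sin th] is at least 1 on the cap [1 - cos th <= eta]; its integral is explicit. *)
Definition cap_weight (eta th : R) : R := sin th * (4 * eta ^ 2 * / (eta + 1 - cos th) ^ 2).

Lemma cap_denominator_pos (eta th : R) : 0 < eta -> 0 < eta + 1 - cos th.
Proof. generalize (COS_bound th); lra. Qed.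

Lemma cap_weight_continuous (eta th : R) : 0 < eta -> continuous (cap_weight eta) th.
Proof.
  intros He. apply (ex_derive_continuous (V := R_NormedModule)).
  unfold cap_weight; auto_derive.
  generalize (cap_denominator_pos eta th He); intros.
  apply Rgt_not_eq; nra.
Qed.

Lemma RInt_cap_weight_le (eta : R) : 0 < eta -> RInt (cap_weight eta) 0 PI <= 4 * eta.
Proof.
  intros He.
  rewrite (RInt_derivative (fun th => - (4 * eta ^ 2) * / (eta + 1 - cos th))).
  - rewrite cos_PI, cos_0.
    apply Rle_trans with (4 * eta - 4 * eta ^ 2 * / (eta + 2)).
    + right; field; lra.
    + assert (0 < 4 * eta ^ 2 * / (eta + 2)); [|lra].
      apply Rmult_lt_0_compat; [nra|apply Rinv_0_lt_compat; lra].
  - intros th; generalize (cap_denominator_pos eta th He); intros H.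
    unfold cap_weight; auto_derive; [lra|field; lra].
  - intros; apply cap_weight_continuous, He.
Qed.

Section Decay.
Context (u : event -> R) (D : axis -> event -> R) (D2 : axis -> axis -> event -> R).
Context (M rho : R).
Context (Hjet : jet2 u D D2).
Context (Hwave : forall p, 0 < fst p ->
  D2 axT axT p = D2 ax1 ax1 p + D2 ax2 ax2 p + D2 ax3 ax3 p).
Context (Hbound : forall X, Rabs (u (0, X)) <= M /\ forall i, Rabs (D i (0, X)) <= M).
Context (Hsupp : forall X, rho < radius X -> u (0, X) = 0 /\ forall i, D i (0, X) = 0).

Lemma data_bound_nonneg : 0 <= M.
Proof. eapply Rle_trans; [apply Rabs_pos|exact (proj1 (Hbound (0, 0, 0)))]. Qed.

(** Since [X = - R c], the law of cosines gives [|X + T omega|^2 = (T - R)^2 + 2 R T (1 - cos th)],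
    which decides whether the point can lie in the support. In the bound, [4 * T] counts the time
    derivative and the three terms of [omega . grad u], each at most [M]. *)
Lemma flux_data_bound (T : R) (X : space) : 0 <= T ->
  exists a b c : vec, orthonormal_frame a b c /\
  forall th ph, exists Phi, cone_flux u D T X a b c T th ph = sin th * Phi /\
    Rabs Phi <= M * (1 + 4 * T) /\
    (rho ^ 2 < (T - radius X) ^ 2 + 2 * radius X * T * (1 - cos th) -> Phi = 0).
Proof.
  intros HT.
  destruct (frame_at X) as (a & b & c & HX & HF & aa & bb & cc & ab & ac & bc).
  exists a, b, c; split; [exact HF|]; intros th ph.
  remember (radius X) as r eqn:Er.
  assert (Hom : dot (omega a b c th ph) (omega a b c th ph) = 1 /\
                dot (omega a b c th ph) c = cos th).
  { generalize (sin2_cos2 th) (sin2_cos2 ph); unfold Rsqr; intros St Sp.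
    unfold dot, omega, horizontal in *; split; [|].
    - transitivity (sin th * sin th * (cos ph * cos ph * (a ax1 * a ax1 + a ax2 * a ax2 + a ax3 * a ax3)
       + sin ph * sin ph * (b ax1 * b ax1 + b ax2 * b ax2 + b ax3 * b ax3)
       + 2 * sin ph * cos ph * (a ax1 * b ax1 + a ax2 * b ax2 + a ax3 * b ax3))
       + cos th * cos th * (c ax1 * c ax1 + c ax2 * c ax2 + c ax3 * c ax3)
       + 2 * sin th * cos th * (cos ph * (a ax1 * c ax1 + a ax2 * c ax2 + a ax3 * c ax3)
          + sin ph * (b ax1 * c ax1 + b ax2 * c ax2 + b ax3 * c ax3))); [ring|].
      rewrite aa, bb, cc, ab, ac, bc.
      transitivity (sin th * sin th * (sin ph * sin ph + cos ph * cos ph) + cos th * cos th); [ring|].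
      rewrite Sp; lra.
    - transitivity (cos th * (c ax1 * c ax1 + c ax2 * c ax2 + c ax3 * c ax3)
       + sin th * (cos ph * (a ax1 * c ax1 + a ax2 * c ax2 + a ax3 * c ax3)
          + sin ph * (b ax1 * c ax1 + b ax2 * c ax2 + b ax3 * c ax3))); [ring|].
      rewrite cc, ac, bc; ring. }
  destruct Hom as [Hoo Hoc].
  assert (Ho : forall i, i <> axT -> Rabs (omega a b c th ph i) <= 1).
  { intros i Hi; apply Rabs_le; unfold dot in Hoo.
    destruct i; [congruence| | | ]; split; nra. }
  unfold cone_flux; rewrite HX; unfold cone; rewrite Rminus_diag.
  set (Y := (- r * c ax1 + T * omega a b c th ph ax1,
             - r * c ax2 + T * omega a b c th ph ax2,
             - r * c ax3 + T * omega a b c th ph ax3)).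
  destruct (Hbound Y) as [Bu BD].
  eexists; split; [reflexivity|split].
  - replace (M * (1 + 4 * T)) with (M + T * (M + (1 * M + 1 * M + 1 * M))) by ring.
    unfold dot_grad.
    apply Rabs_Rplus_le; [exact Bu|].
    apply Rabs_Rmult_le; [rewrite Rabs_pos_eq; lra|].
    apply Rabs_Rplus_le; [apply BD|].
    repeat apply Rabs_Rplus_le; apply Rabs_Rmult_le;
      first [apply BD | apply Ho; discriminate].
  - intros Hfar.
    assert (HY : rho < radius Y).
    { apply Rnot_le_lt; intros Hle.
      assert (E : radius Y ^ 2 = (T - r) ^ 2 + 2 * r * T * (1 - cos th)).
      { unfold Y; rewrite radius_sqr, <- Hoc.
        unfold dot in *.
        transitivity (r ^ 2 * (c ax1 * c ax1 + c ax2 * c ax2 + c ax3 * c ax3)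
          + T ^ 2 * (omega a b c th ph ax1 * omega a b c th ph ax1 +
              omega a b c th ph ax2 * omega a b c th ph ax2 +
              omega a b c th ph ax3 * omega a b c th ph ax3)
          - 2 * r * T * (omega a b c th ph ax1 * c ax1 + omega a b c th ph ax2 * c ax2 +
              omega a b c th ph ax3 * c ax3)); [ring|].
        rewrite Hoo, cc; ring. }
      generalize (radius_ge_0 Y); nra. }
    destruct (Hsupp Y HY) as [Su SD]; unfold dot_grad.
    transitivity (0 + T * (0 + (omega a b c th ph ax1 * 0 + omega a b c th ph ax2 * 0
      + omega a b c th ph ax3 * 0))); [|ring].
    repeat f_equal; first [exact Su | apply SD].
Qed.

(** The regimes of the decay estimate differ only in the majorant [g]. The factor one half comes
    from [4 * PI * |u| <= 2 * PI * G]. *)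
Lemma solution_bound (g : R -> R) (G T : R) (X : space) : 0 <= T ->
  (forall t, continuous g t) -> RInt g 0 PI <= G ->
  (forall th Phi, 0 <= th <= PI -> Rabs Phi <= M * (1 + 4 * T) ->
    (rho ^ 2 < (T - radius X) ^ 2 + 2 * radius X * T * (1 - cos th) -> Phi = 0) ->
    Rabs (sin th * Phi) <= g th) ->
  Rabs (u (T, X)) <= G / 2.
Proof.
  intros HT Hg HG Hle.
  destruct (flux_data_bound T X HT) as (a & b & c & HF & Hflux).
  assert (HK := kirchhoff u D D2 T X a b c Hjet HF Hwave HT).
  assert (HB : Rabs (angular_int (cone_flux u D T X a b c T)) <= 2 * PI * RInt g 0 PI).
  { apply angular_int_abs_le; [|exact Hg|].
    - apply continuous3_apply with (f := cone_flux u D T X a b c).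
      apply (integrands_continuous u D D2 T X a b c Hjet).
    - intros th ph Hth; destruct (Hflux th ph) as (Phi & -> & H1 & H2).
      apply Hle; assumption. }
  rewrite <- HK, Rabs_mult, Rabs_pos_eq in HB by (generalize PI_RGT_0; lra).
  generalize PI_RGT_0; intros; nra.
Qed.

Lemma sin_nonneg (th : R) : 0 <= th <= PI -> 0 <= sin th.
Proof. intros; apply sin_ge_0; lra. Qed.

Lemma wave_decay : 1 <= rho -> exists C, forall T X, 0 <= T ->
  (1 + T + radius X) * sqrt (1 + Rabs (T - radius X)) * Rabs (u (T, X)) <= C.
Proof.
  intros Hrho; assert (HM := data_bound_nonneg).
  (* [1 + rho] bounds the square root on the strip. Of the two summands, the first settles
     [T <= 2 * rho + 1], where [1 + T + r <= 3 + 5 * rho] and [1 + 4 * T <= 5 + 8 * rho]; the second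
     settles larger times. *)
  exists ((1 + rho) * ((3 + 5 * rho) * (M * (5 + 8 * rho)) + 40 * M * rho ^ 2)).
  intros T X HT; set (r := radius X); assert (Hr := radius_ge_0 X); fold r in Hr.
  destruct (Rlt_le_dec rho (Rabs (T - r))) as [Hfar|Hnear].
  - assert (H0 : Rabs (u (T, X)) <= 0 / 2).
    { apply solution_bound with (g := fun _ => 0); auto.
      - intros; apply continuous_const.
      - rewrite RInt_const; right; apply Rmult_0_r.
      - intros th Phi Hth _ HPhi; fold r in HPhi; rewrite HPhi.
        + rewrite Rmult_0_r, Rabs_R0; lra.
        + generalize (COS_bound th); intros.
          assert (0 <= r * T) by nra. assert (0 <= (r * T) * (1 - cos th)) by nra.
          rewrite <- (pow2_abs (T - r)). nra. }
    assert (E : Rabs (u (T, X)) = 0) by (generalize (Rabs_pos (u (T, X))); lra).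
    rewrite E, Rmult_0_r.
    assert (0 <= M * (5 + 8 * rho)) by nra. assert (0 <= M * rho ^ 2) by nra. nra.
  - assert (Hs : 0 <= sqrt (1 + Rabs (T - r)) <= 1 + rho).
    { split; [apply sqrt_pos|].
      rewrite <- (sqrt_pow2 (1 + rho)) by lra; apply sqrt_le_1_alt.
      generalize (Rabs_pos (T - r)); nra. }
    apply Rabs_le_between in Hnear.
    assert (Hmain : (1 + T + r) * Rabs (u (T, X)) <=
       (3 + 5 * rho) * (M * (5 + 8 * rho)) + 40 * M * rho ^ 2).
    (* Above this threshold [r >= T - rho] is at least [T / 2], and [T >= 1] absorbs the additive
       constants. Below it, the bound by the full sphere suffices. *)
    { destruct (Rle_lt_dec T (2 * rho + 1)) as [Hsmall|Hlarge].
      - assert (H0 : Rabs (u (T, X)) <= 2 * (M * (1 + 4 * T)) / 2).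
        { apply solution_bound with (g := fun th => M * (1 + 4 * T) * sin th); auto.
          - intros; continuity_tac.
          - right; transitivity (M * (1 + 4 * T) * RInt sin 0 PI).
            + apply (RInt_scal (V := R_CompleteNormedModule)).
              apply continuous_ex_RInt, continuous_sin.
            + rewrite RInt_sin_0_PI; ring.
          - intros th Phi Hth HPhi _.
            rewrite Rabs_mult, Rabs_pos_eq by (apply sin_nonneg, Hth).
            generalize (sin_nonneg th Hth); nra. }
        assert (0 <= Rabs (u (T, X)) <= M * (5 + 8 * rho))
          by (generalize (Rabs_pos (u (T, X))); nra).
        assert (0 <= M * rho ^ 2) by nra.
        apply Rle_trans with ((3 + 5 * rho) * (M * (5 + 8 * rho))); [|nra].
        apply Rmult_le_compat; lra.
      (* Chosen so that [T ^ 2 * eta = rho ^ 2]: the sphere can meet the support only where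
         [1 - cos th <= eta]. *)
      - set (eta := rho ^ 2 / T ^ 2).
        assert (HT0 : 0 < T) by lra.
        assert (HeT : eta * T ^ 2 = rho ^ 2) by (unfold eta; field; lra).
        assert (Heta : 0 < eta) by (apply Rdiv_lt_0_compat; nra).
        assert (HK : 0 <= M * (1 + 4 * T)) by nra.
        assert (H0 : Rabs (u (T, X)) <= M * (1 + 4 * T) * (4 * eta) / 2).
        { apply solution_bound with (g := fun th => M * (1 + 4 * T) * cap_weight eta th); auto.
          - intros; apply (continuous_mult (K := R_AbsRing)); [apply continuous_const|].
            apply cap_weight_continuous, Heta.
          - apply Rle_trans with (M * (1 + 4 * T) * RInt (cap_weight eta) 0 PI).
            + right; apply (RInt_scal (V := R_CompleteNormedModule)).
              apply continuous_ex_RInt; intros; apply cap_weight_continuous, Heta.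
            + apply Rmult_le_compat_l; [exact HK|apply RInt_cap_weight_le, Heta].
          - intros th Phi Hth HPhi Hz; fold r in Hz.
            rewrite Rabs_mult, Rabs_pos_eq by (apply sin_nonneg, Hth).
            assert (Hsin := sin_nonneg th Hth).
            assert (Hden := cap_denominator_pos eta th Heta).
            assert (Hw : 0 <= 4 * eta ^ 2 * / (eta + 1 - cos th) ^ 2).
            { apply Rmult_le_pos; [nra|left; apply Rinv_0_lt_compat; nra]. }
            unfold cap_weight.
            rewrite <- Rmult_assoc, (Rmult_comm _ (sin th)), Rmult_assoc.
            apply Rmult_le_compat_l; [exact Hsin|].
            destruct (Rle_lt_dec (1 - cos th) eta) as [Hin|Hout].
            + apply Rle_trans with (M * (1 + 4 * T) * 1); [lra|].
              apply Rmult_le_compat_l; [exact HK|].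
              apply Rmult_le_reg_r with ((eta + 1 - cos th) ^ 2); [nra|].
              rewrite Rmult_assoc, Rinv_l, Rmult_1_l, Rmult_1_r by nra.
              generalize (COS_bound th); nra.
            + rewrite Hz; [rewrite Rabs_R0; apply Rmult_le_pos; assumption|].
              (* Outside of the cap, [2 r T (1 - cos th) >= T^2 (1 - cos th) > T^2 eta = rho^2],
                 hence [Phi] vanishes. *)
              assert (Hrt : T <= 2 * r) by lra.
              assert (T ^ 2 <= 2 * r * T) by nra.
              assert (T ^ 2 * eta < 2 * r * T * (1 - cos th));
                [|generalize (pow2_ge_0 (T - r)); lra].
              apply Rlt_le_trans with (T ^ 2 * (1 - cos th)); [|nra].
              apply Rmult_lt_compat_l; nra. }
        assert (HeT1 : eta * T <= rho ^ 2).
        { rewrite <- HeT. nra. }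
        assert (0 <= (3 + 5 * rho) * (M * (5 + 8 * rho))).
        { apply Rmult_le_pos; [lra|apply Rmult_le_pos; lra]. }
        apply Rle_trans with (40 * M * rho ^ 2); [|lra].
        (* Here [1 + T + r <= 4 * T] and [1 + 4 * T <= 5 * T], so the product is
           [40 * M * (eta * T ^ 2)]. *)
        apply Rle_trans with ((4 * T) * (M * (5 * T) * (4 * eta) / 2)).
        + apply Rmult_le_compat; [lra|apply Rabs_pos|lra|].
          eapply Rle_trans; [exact H0|].
          assert (0 <= M * eta) by nra. nra.
        + rewrite <- HeT; right; field. }
    assert (0 <= (1 + T + r) * Rabs (u (T, X)))
      by (apply Rmult_le_pos; [lra|apply Rabs_pos]).
    nra.
Qed.
End Decay.

(** * Partial derivatives in the half-space *)

Definition deriv_along (i : axis) (f : event -> R) (p : event) (l : R) : Prop :=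
  is_derive (fun s => f (set_coordinate i p s)) (coordinate i p) l.

Lemma set_coordinate_id (i : axis) (p : event) : set_coordinate i p (coordinate i p) = p.
Proof. destruct p as [T [[x1 x2] x3]], i; reflexivity. Qed.

Lemma continuous_set_coordinate (i : axis) (p : event) (s : R) :
  continuous (set_coordinate i p) s.
Proof.
  destruct p as [T [[x1 x2] x3]], i; simpl; apply continuous_event;
    first [apply continuous_const | apply continuous_id].
Qed.

Lemma locally_set_coordinate (i : axis) (p : event) (O : event -> Prop) :
  locally p O -> locally (coordinate i p) (fun s => O (set_coordinate i p s)).
Proof.
  intros H; apply (continuous_set_coordinate i p (coordinate i p)).
  rewrite set_coordinate_id; exact H.
Qed.

(** Where the coordinate line stays in the half-space near [p], restricting to the half-space leaves
    the neighbourhood filter unchanged and [is_partial] is the ordinary derivative. In the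
    half-space this fails only for [axT] at [T = 0]. *)
Definition two_sided (i : axis) (p : event) : Prop :=
  locally (coordinate i p) (fun s => half_space (set_coordinate i p s)).

Lemma two_sided_future (i : axis) (p : event) : 0 < fst p -> two_sided i p.
Proof.
  intros H; apply locally_set_coordinate.
  generalize (locally_future p H); apply filter_imp; intros q Hq; apply Rlt_le, Hq.
Qed.

Lemma two_sided_spatial (i : axis) (p : event) : i <> axT -> 0 <= fst p -> two_sided i p.
Proof.
  intros Hi H; unfold two_sided; apply filter_forall; intros s; unfold half_space.
  destruct p as [T [[x1 x2] x3]], i; simpl in *; congruence || assumption.
Qed.

Lemma is_partial_iff (i : axis) (f : event -> R) (p : event) (l : R) :
  two_sided i p -> is_partial i f p l <-> deriv_along i f p l.
Proof.
  intros Hts; unfold is_partial, deriv_along, is_derive, filterdiff.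
  set (Dm := fun s : R => half_space (set_coordinate i p s)).
  assert (HF : forall Q : R -> Prop, within Dm (locally (coordinate i p)) Q <-> locally (coordinate i p) Q).
  { intros Q; unfold within; split; intros H.
    - generalize (filter_and _ _ H Hts); apply filter_imp; intros s [H1 H2]; auto.
    - revert H; apply filter_imp; auto. }
  split; intros [Hl H]; split; try exact Hl; intros x Hx eps; apply HF; apply H;
    intros Q HQ; apply HF, Hx, HQ.
Qed.

Lemma partial_eq (i : axis) (f : event -> R) (p : event) (l : R) :
  two_sided i p -> deriv_along i f p l -> partial i f p = l.
Proof.
  intros Hts H; unfold partial; apply (iota_unique (V := R_CompleteNormedModule)).
  - intros y Hy; apply is_partial_iff in Hy; [|exact Hts].
    rewrite <- (is_derive_unique _ _ _ H); symmetry; apply is_derive_unique, Hy.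
  - apply is_partial_iff; assumption.
Qed.

Lemma partial_correct (i : axis) (f : event -> R) (p : event) :
  two_sided i p -> (exists l, is_partial i f p l) -> deriv_along i f p (partial i f p).
Proof.
  intros Hts [l Hl]; apply is_partial_iff in Hl; [|exact Hts].
  rewrite (partial_eq i f p l); assumption.
Qed.

Lemma deriv_along_ext (i : axis) (f g : event -> R) (p : event) (l : R) :
  locally p (fun q => f q = g q) -> deriv_along i f p l -> deriv_along i g p l.
Proof.
  intros H; apply (is_derive_ext_loc (K := R_AbsRing) (V := R_NormedModule)).
  apply (locally_set_coordinate i p (fun q => f q = g q)); exact H.
Qed.

Lemma deriv_along_eq (i : axis) (f : event -> R) (p : event) (l m : R) :
  deriv_along i f p l -> l = m -> deriv_along i f p m.
Proof. intros H <-; exact H. Qed.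

Lemma deriv_along_const (i : axis) (c : R) (p : event) : deriv_along i (fun _ => c) p 0.
Proof. unfold deriv_along; apply (is_derive_const (V := R_NormedModule)). Qed.

Lemma deriv_along_plus (i : axis) (f g : event -> R) (p : event) (l m : R) :
  deriv_along i f p l -> deriv_along i g p m ->
  deriv_along i (fun q => f q + g q) p (l + m).
Proof. apply is_derive_Rplus. Qed.

Lemma deriv_along_opp (i : axis) (f : event -> R) (p : event) (l : R) :
  deriv_along i f p l -> deriv_along i (fun q => - f q) p (- l).
Proof. intros H; apply (is_derive_opp (V := R_NormedModule)); exact H. Qed.

Lemma deriv_along_minus (i : axis) (f g : event -> R) (p : event) (l m : R) :
  deriv_along i f p l -> deriv_along i g p m ->
  deriv_along i (fun q => f q - g q) p (l - m).
Proof. intros; apply deriv_along_plus; [|apply deriv_along_opp]; assumption. Qed.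

Lemma deriv_along_mult (i : axis) (f g : event -> R) (p : event) (l m : R) :
  deriv_along i f p l -> deriv_along i g p m ->
  deriv_along i (fun q => f q * g q) p (l * g p + f p * m).
Proof.
  intros Hf Hg; generalize (is_derive_Rmult _ _ _ _ _ Hf Hg).
  rewrite set_coordinate_id; trivial.
Qed.

Definition axis_eqb (i j : axis) : bool :=
  match i, j with
  | axT, axT | ax1, ax1 | ax2, ax2 | ax3, ax3 => true
  | _, _ => false
  end.

Lemma deriv_along_coordinate (i j : axis) (p : event) :
  deriv_along i (coordinate j) p (if axis_eqb i j then 1 else 0).
Proof.
  destruct p as [T [[x1 x2] x3]], i, j; unfold deriv_along; simpl;
  first [apply (is_derive_id (K := R_AbsRing)) | apply (is_derive_const (V := R_NormedModule))].
Qed.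

Lemma is_derive_sqrt_sqr (k x : R) : 0 < x ^ 2 + k ->
  is_derive (fun s => sqrt (s ^ 2 + k)) x (x / sqrt (x ^ 2 + k)).
Proof.
  intros H; assert (H' := sqrt_lt_R0 _ H).
  auto_derive; replace (x * (x * 1)) with (x ^ 2) by ring; [lra|].
  field; lra.
Qed.

Lemma deriv_along_radius (i : axis) (p : event) : 0 < radius (snd p) ->
  deriv_along i (fun q => radius (snd q)) p
    (if axis_eqb i axT then 0 else coordinate i p / radius (snd p)).
Proof.
  destruct p as [T [[x1 x2] x3]]; intros H; unfold deriv_along.
  assert (H2 : 0 < x1 ^ 2 + x2 ^ 2 + x3 ^ 2).
  { cbn [snd] in H; rewrite <- radius_sqr; nra. }
  destruct i; cbn [axis_eqb coordinate set_coordinate snd]; unfold radius.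
  - apply (is_derive_const (V := R_NormedModule)).
  - replace (x1 ^ 2 + x2 ^ 2 + x3 ^ 2) with (x1 ^ 2 + (x2 ^ 2 + x3 ^ 2)) in * by ring.
    eapply is_derive_ext; [|apply (is_derive_sqrt_sqr (x2 ^ 2 + x3 ^ 2)); exact H2].
    intros s; simpl; f_equal; ring.
  - replace (x1 ^ 2 + x2 ^ 2 + x3 ^ 2) with (x2 ^ 2 + (x1 ^ 2 + x3 ^ 2)) in * by ring.
    eapply is_derive_ext; [|apply (is_derive_sqrt_sqr (x1 ^ 2 + x3 ^ 2)); exact H2].
    intros s; simpl; f_equal; ring.
  - replace (x1 ^ 2 + x2 ^ 2 + x3 ^ 2) with (x3 ^ 2 + (x1 ^ 2 + x2 ^ 2)) in * by ring.
    eapply is_derive_ext; [|apply (is_derive_sqrt_sqr (x1 ^ 2 + x2 ^ 2)); exact H2].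
    intros s; simpl; f_equal; ring.
Qed.

Lemma deriv_along_inv (i : axis) (f : event -> R) (p : event) (l : R) : f p <> 0 ->
  deriv_along i f p l -> deriv_along i (fun q => / f q) p (- l / f p ^ 2).
Proof.
  intros H0 Hf.
  assert (H := is_derive_inv _ _ _ Hf); cbv beta in H; rewrite set_coordinate_id in H; exact (H H0).
Qed.

(** * Symmetry of second partial derivatives *)

Lemma continuous_set_coordinate2 (i j : axis) (p : event) (z : R * R) :
  continuous (fun z : R * R => set_coordinate i (set_coordinate j p (snd z)) (fst z)) z.
Proof.
  destruct p as [T [[x1 x2] x3]], i, j; simpl; apply continuous_event;
    first [apply continuous_const | apply continuous_fst | apply continuous_snd].
Qed.

(** Schwarz's theorem for the restriction of [f] to the coordinate plane through [p] in the
    directions [i] and [j]. The work lies in identifying iterated [Derive]s of the restriction with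
    iterated [partial]s, which must hold on neighbourhoods and not just at [p]. *)
Lemma partial_comm (f : event -> R) (p : event) (i j : axis) :
  locally p (fun q => 0 < fst q /\ (forall i, exists l, is_partial i f q l) /\
    forall i j, exists l, is_partial i (partial j f) q l) ->
  (forall i j, continuous (partial i (partial j f)) p) ->
  partial i (partial j f) p = partial j (partial i f) p.
Proof.
  intros Hloc Hc.
  set (good := fun q => 0 < fst q /\ (forall i, deriv_along i f q (partial i f q)) /\
    forall i j, deriv_along i (partial j f) q (partial i (partial j f) q)).
  assert (Hgood : locally p good).
  { revert Hloc; apply filter_imp; intros q (Hq & H1 & H2).
    split; [exact Hq|split]; intros; apply partial_correct; auto using two_sided_future. }
  clear Hloc.
  assert (Hij : i = j \/ i <> j) by (destruct i, j; (now left) || (now right)).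
  destruct Hij as [->|Hij]; [reflexivity|].
  set (pt := fun u v => set_coordinate i (set_coordinate j p v) u).
  set (x := coordinate i p); set (y := coordinate j p).
  assert (Ept : pt x y = p) by (unfold pt, x, y; rewrite !set_coordinate_id; reflexivity).
  assert (Cpt : forall z, continuous (fun z : R * R => pt (fst z) (snd z)) z)
    by (intros; apply continuous_set_coordinate2).
  assert (Hi : forall u v, coordinate i (pt u v) = u /\ coordinate j (pt u v) = v /\
     (forall s, set_coordinate i (pt u v) s = pt s v) /\
     (forall s, set_coordinate j (pt u v) s = pt u s)).
  { intros u v; unfold pt; destruct p as [T [[x1 x2] x3]], i, j; try congruence;
    repeat split. }
  assert (Hg2 : locally (x, y) (fun z : R * R => good (pt (fst z) (snd z)))).
  { apply (Cpt (x, y)); cbn [fst snd]; rewrite Ept; exact Hgood. }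
  assert (Hrow : forall u v, good (pt u v) -> forall k,
      (is_derive (fun z => f (pt z v)) u (partial i f (pt u v)) /\
       is_derive (fun z => f (pt u z)) v (partial j f (pt u v))) /\
      is_derive (fun z => partial k f (pt z v)) u (partial i (partial k f) (pt u v)) /\
      is_derive (fun z => partial k f (pt u z)) v (partial j (partial k f) (pt u v))).
  { intros u v (_ & G1 & G2) k; destruct (Hi u v) as (E1 & E2 & E3 & E4).
    generalize (G1 i) (G1 j) (G2 i k) (G2 j k); unfold deriv_along; rewrite E1, E2.
    intros D1 D2 D3 D4; (split; [split|split]);
      (eapply is_derive_ext; [|first [exact D1|exact D2|exact D3|exact D4]]);
      intros s; simpl; rewrite ?E3, ?E4; reflexivity. }
  assert (Hsl : forall u v, locally (u, v) (fun z : R * R => good (pt (fst z) (snd z))) ->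
      locally u (fun z => good (pt z v)) /\ locally v (fun z => good (pt u z))).
  { intros u v H; split.
    - apply (continuous_pair (fun z : R => z) (fun _ => v) u
        (continuous_id u) (continuous_const v u) _ H).
    - apply (continuous_pair (fun _ => u) (fun z : R => z) v
        (continuous_const u v) (continuous_id v) _ H). }
  set (F := fun u v => f (pt u v)).
  assert (Hd : forall u v, locally (u, v) (fun z : R * R => good (pt (fst z) (snd z))) ->
      is_derive (fun z => Derive (fun t => F z t) v) u (partial i (partial j f) (pt u v)) /\
      is_derive (fun z => Derive (fun t => F t z) u) v (partial j (partial i f) (pt u v))).
  { intros u v H; destruct (Hsl u v H) as [S1 S2].
    assert (G := locally_singleton _ _ S1). split.
    - eapply is_derive_ext_loc; [|apply (Hrow u v G j)].
      revert S1; apply filter_imp; intros z Gz; symmetry; apply is_derive_unique, (Hrow z v Gz j).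
    - eapply is_derive_ext_loc; [|apply (Hrow u v G i)].
      revert S2; apply filter_imp; intros z Gz; symmetry; apply is_derive_unique, (Hrow u z Gz i). }
  assert (Hll := locally_locally _ _ Hg2).
  assert (Hcc : forall k l, continuity_2d_pt (fun u v => partial k (partial l f) (pt u v)) x y).
  { intros k l; apply continuous_2d_iff.
    apply (continuous_comp (fun z : R * R => pt (fst z) (snd z)) (partial k (partial l f)));
      [apply Cpt|cbn [fst snd]; rewrite Ept; apply Hc]. }
  rewrite <- Ept.
  rewrite <- (is_derive_unique _ _ _ (proj1 (Hd x y Hg2))),
    <- (is_derive_unique _ _ _ (proj2 (Hd x y Hg2))).
  apply Schwarz.
  - apply locally_2d_locally; revert Hll; apply filter_imp; intros [u v] H; cbn [fst snd] in *.
    assert (G := locally_singleton _ _ H); cbn [fst snd] in G.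
    destruct (Hrow u v G axT) as [[R1 R2] _]; destruct (Hd u v H) as [D1 D2].
    split; [|split; [|split]]; eexists; eassumption.
  - eapply continuity_2d_pt_ext_loc; [|apply (Hcc i j)].
    apply locally_2d_locally; revert Hll; apply filter_imp; intros [u v] H; cbn [fst snd] in *.
    symmetry; apply is_derive_unique, (Hd u v H).
  - eapply continuity_2d_pt_ext_loc; [|apply (Hcc j i)].
    apply locally_2d_locally; revert Hll; apply filter_imp; intros [u v] H; cbn [fst snd] in *.
    symmetry; apply is_derive_unique, (Hd u v H).
Qed.

(** * The rescaled derivative solves the wave equation *)

Lemma locally_and {U : UniformSpace} (x : U) (P Q : U -> Prop) :
  locally x P -> locally x Q -> locally x (fun y => P y /\ Q y).
Proof. apply filter_and. Qed.

Lemma smooth_partial (Dom : event -> Prop) (f : event -> R) (i : axis) :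
  smooth_on Dom f -> smooth_on Dom (partial i f).
Proof. intros H n; exact (proj2 (proj2 (H (S n)) i)). Qed.

Lemma smooth_ex_partial (Dom : event -> Prop) (f : event -> R) (i : axis) (p : event) :
  smooth_on Dom f -> Dom p -> exists l, is_partial i f p l.
Proof. intros H; exact (proj1 (proj2 (H 1%nat) i) p). Qed.

Lemma smooth_continuous (Dom : event -> Prop) (f : event -> R) (p : event) :
  smooth_on Dom f -> locally p Dom -> continuous f p.
Proof.
  intros H Hp Q HQ.
  assert (Hw : locally p (fun q => Dom q -> Q (f q)))
    by exact (proj1 (H 0%nat) p (locally_singleton _ _ Hp) Q HQ).
  change (locally p (fun q => Q (f q))); generalize (locally_and _ _ _ Hp Hw).
  apply filter_imp; intros q [H1 H2]; exact (H2 H1).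
Qed.

Lemma smooth_deriv_along (Dom : event -> Prop) (f : event -> R) (i : axis) (p : event) :
  smooth_on Dom f -> Dom p -> 0 < fst p -> deriv_along i f p (partial i f p).
Proof.
  intros H Hp Hf; apply partial_correct; [apply two_sided_future, Hf|].
  apply (smooth_ex_partial Dom); assumption.
Qed.

Lemma smooth_partial_comm (Dom : event -> Prop) (f : event -> R) (i j : axis) (p : event) :
  smooth_on Dom f -> locally p Dom -> 0 < fst p ->
  partial i (partial j f) p = partial j (partial i f) p.
Proof.
  intros H Hp Hf; apply partial_comm.
  - generalize (locally_and _ _ _ Hp (locally_future p Hf)); apply filter_imp.
    intros q [H1 H2]; split; [exact H2|split]; intros;
      apply (smooth_ex_partial Dom); auto using smooth_partial.
  - intros; apply (smooth_continuous Dom); auto using smooth_partial.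
Qed.

Lemma continuous_radius (X : space) : continuous radius X.
Proof.
  apply continuous_ext with (fun X : space =>
    sqrt (fst (fst X) * fst (fst X) + snd (fst X) * snd (fst X) + snd X * snd X)).
  - intros [[x1 x2] x3]; simpl; f_equal; ring.
  - apply (continuous_Rcomp sqrt (fun X : space =>
      fst (fst X) * fst (fst X) + snd (fst X) * snd (fst X) + snd X * snd X)).
    + intros; apply continuous_sqrt.
    + destruct (coordinates_continuous X) as (H1 & H2 & H3); continuity_tac.
Qed.

(** The open region where all partial derivatives are two-sided and [radius] is smooth. Being open,
    it allows an identity proved on it to be differentiated again. *)
Definition exterior (p : event) : Prop := 0 < fst p /\ 0 < radius (snd p).

Lemma exterior_punctured (p : event) : exterior p -> punctured_half_space p.
Proof. intros [H1 H2]; split; [apply Rlt_le|]; assumption. Qed.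

Lemma locally_exterior (p : event) : exterior p -> locally p exterior.
Proof.
  intros [H1 H2]; apply (locally_and p); [apply locally_future, H1|].
  apply (continuous_comp (snd : event -> space) radius p (continuous_snd _ _)
    (continuous_radius _) (fun r => 0 < r)).
  apply (open_gt 0); exact H2.
Qed.

Lemma locally_punctured (p : event) : exterior p -> locally p punctured_half_space.
Proof.
  intros H; generalize (locally_exterior p H); apply filter_imp; exact exterior_punctured.
Qed.

Lemma partial_eq_exterior (i : axis) (f g : event -> R) (p : event) (l : R) :
  (forall q, exterior q -> f q = g q) -> exterior p -> deriv_along i g p l -> partial i f p = l.
Proof.
  intros Hfg Hp Hg; apply partial_eq; [apply two_sided_future, Hp|].
  apply deriv_along_ext with g; [|exact Hg].
  generalize (locally_exterior p Hp); apply filter_imp; intros; symmetry; auto.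
Qed.

Lemma d_R_eq (f : event -> R) (p : event) :
  smooth_on punctured_half_space f -> exterior p ->
  radius (snd p) * d_R f p = coordinate ax1 p * partial ax1 f p
    + coordinate ax2 p * partial ax2 f p + coordinate ax3 p * partial ax3 f p.
Proof.
  intros Hf Hp; assert (Hr := proj2 Hp).
  destruct p as [T [[x1 x2] x3]]; cbn [fst snd] in *; set (r := radius (x1, x2, x3)) in *.
  assert (Er : (T, (r / r * x1, r / r * x2, r / r * x3)) = (T, (x1, x2, x3))).
  { unfold Rdiv; rewrite !Rinv_r, !Rmult_1_l by lra; reflexivity. }
  unfold d_R, dilate; fold r.
  rewrite (is_derive_unique _ _ (0 * partial axT f (T, (x1, x2, x3)) +
     (x1 / r * partial ax1 f (T, (x1, x2, x3)) + (x2 / r * partial ax2 f (T, (x1, x2, x3))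
      + x3 / r * partial ax3 f (T, (x1, x2, x3)))))).
  - set (p := (T, (x1, x2, x3)) : event).
    change (r * (0 * partial axT f p + (x1 / r * partial ax1 f p + (x2 / r * partial ax2 f p
      + x3 / r * partial ax3 f p))) = x1 * partial ax1 f p + x2 * partial ax2 f p + x3 * partial ax3 f p).
    field; lra.
  - generalize (is_derive_curve f (fun i => partial i f) (fun _ => T)
      (fun s => s / r * x1) (fun s => s / r * x2) (fun s => s / r * x3)
      0 (x1 / r) (x2 / r) (x3 / r) r); cbv zeta beta; rewrite Er.
    intros H; apply H; clear H.
    + generalize (locally_exterior (T, (x1, x2, x3)) Hp); apply filter_imp; intros q Hq i.
      apply (smooth_deriv_along punctured_half_space); [exact Hf|apply exterior_punctured, Hq|apply Hq].
    + intros i; apply (smooth_continuous punctured_half_space);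
        [apply smooth_partial, Hf|apply locally_punctured, Hp].
    + apply (is_derive_const (V := R_NormedModule)).
    + auto_derive; [exact I|field; lra].
    + auto_derive; [exact I|field; lra].
    + auto_derive; [exact I|field; lra].
Qed.

Section RescaledUgly.
Context (phi phi1 : event -> R).
Context (Hphi : smooth_on punctured_half_space phi).
Context (Hugly : forall p, punctured_half_space p ->
  box phi p = 2 / radius (snd p) * partial axT phi p).
Context (Hphi1 : forall p, punctured_half_space p ->
  phi1 p = radius (snd p) * nabla_psi phi p).

Let rad (p : event) : R := radius (snd p).

(** In this Cartesian form the radial derivative is gone and only coordinate derivatives with
    explicit coefficients remain, so that iterated partials can be computed mechanically. *)
Lemma phi1_eq (p : event) : exterior p ->
  phi1 p = rad p * partial axT phi p - (coordinate ax1 p * partial ax1 phi p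
    + coordinate ax2 p * partial ax2 phi p + coordinate ax3 p * partial ax3 phi p).
Proof.
  intros Hp; rewrite (Hphi1 p (exterior_punctured p Hp)); unfold nabla_psi, rad.
  rewrite Rmult_minus_distr_l, d_R_eq; auto.
Qed.

Lemma exterior_deriv_along (i : axis) (f : event -> R) (p : event) :
  smooth_on punctured_half_space f -> exterior p -> deriv_along i f p (partial i f p).
Proof.
  intros Hf Hp; apply (smooth_deriv_along punctured_half_space);
    [exact Hf|apply exterior_punctured, Hp|apply Hp].
Qed.

Ltac derive_along Hp :=
  cbv beta;
  lazymatch goal with
  | |- deriv_along ?i (fun q => @?f q + @?g q) ?p _ =>
      apply (deriv_along_plus i f g p); derive_along Hp
  | |- deriv_along ?i (fun q => @?f q - @?g q) ?p _ =>
      apply (deriv_along_minus i f g p); derive_along Hp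
  | |- deriv_along ?i (fun q => @?f q * @?g q) ?p _ =>
      apply (deriv_along_mult i f g p); derive_along Hp
  | |- deriv_along ?i (fun q => - @?f q) ?p _ =>
      apply (deriv_along_opp i f p); derive_along Hp
  | |- deriv_along ?i (fun q => / radius (snd q)) ?p _ =>
      apply (deriv_along_inv i (fun q => radius (snd q)) p);
      [apply Rgt_not_eq, (proj2 Hp)|derive_along Hp]
  | |- deriv_along ?i (fun q => radius (snd q)) ?p _ =>
      apply (deriv_along_radius i p (proj2 Hp))
  | |- deriv_along ?i (fun q => coordinate ?j q) ?p _ => apply (deriv_along_coordinate i j p)
  | |- deriv_along ?i (fun q => partial ?j ?f q) ?p _ =>
      apply (exterior_deriv_along i (partial j f) p); [repeat apply smooth_partial; exact Hphi|exact Hp]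
  end.

Lemma partial_T_phi1 (p : event) : exterior p ->
  partial axT phi1 p = rad p * partial axT (partial axT phi) p -
    (coordinate ax1 p * partial axT (partial ax1 phi) p
    + coordinate ax2 p * partial axT (partial ax2 phi) p
    + coordinate ax3 p * partial axT (partial ax3 phi) p).
Proof.
  intros Hp; eapply partial_eq_exterior; [exact phi1_eq|exact Hp|].
  eapply deriv_along_eq; [unfold rad; derive_along Hp|].
  simpl; unfold rad; ring.
Qed.

Lemma partial_space_phi1 (i : axis) (p : event) : i <> axT -> exterior p ->
  partial i phi1 p = coordinate i p * / rad p * partial axT phi p
    + rad p * partial i (partial axT phi) p - partial i phi p -
    (coordinate ax1 p * partial i (partial ax1 phi) p
    + coordinate ax2 p * partial i (partial ax2 phi) p
    + coordinate ax3 p * partial i (partial ax3 phi) p).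
Proof.
  intros Hi Hp; eapply partial_eq_exterior; [exact phi1_eq|exact Hp|].
  eapply deriv_along_eq; [unfold rad; derive_along Hp|].
  destruct i; [congruence| | |]; simpl; unfold rad, Rdiv; ring.
Qed.

Lemma partial_TT_phi1 (p : event) : exterior p ->
  partial axT (partial axT phi1) p = rad p * partial axT (partial axT (partial axT phi)) p -
    (coordinate ax1 p * partial axT (partial axT (partial ax1 phi)) p
    + coordinate ax2 p * partial axT (partial axT (partial ax2 phi)) p
    + coordinate ax3 p * partial axT (partial axT (partial ax3 phi)) p).
Proof.
  intros Hp; eapply partial_eq_exterior; [exact partial_T_phi1|exact Hp|].
  eapply deriv_along_eq; [unfold rad; derive_along Hp|].
  simpl; unfold rad; ring.
Qed.

Lemma partial_2_space_phi1 (i : axis) (p : event) : i <> axT -> exterior p ->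
  partial i (partial i phi1) p =
    (/ rad p - coordinate i p ^ 2 / rad p ^ 3) * partial axT phi p
    + 2 * (coordinate i p / rad p) * partial i (partial axT phi) p
    + rad p * partial i (partial i (partial axT phi)) p - 2 * partial i (partial i phi) p -
    (coordinate ax1 p * partial i (partial i (partial ax1 phi)) p
    + coordinate ax2 p * partial i (partial i (partial ax2 phi)) p
    + coordinate ax3 p * partial i (partial i (partial ax3 phi)) p).
Proof.
  intros Hi Hp; eapply partial_eq_exterior;
    [intros q Hq; exact (partial_space_phi1 i q Hi Hq)|exact Hp|].
  assert (Hr := proj2 Hp).
  eapply deriv_along_eq; [unfold rad; derive_along Hp|].
  destruct i; [congruence| | |]; simpl; unfold rad; field; apply Rgt_not_eq, Hr.
Qed.

(** Two swaps. The inner one takes place under a further derivative, hence is needed as an identity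
    on all of [exterior]. *)
Lemma triple_comm (i k : axis) (p : event) : exterior p ->
  partial i (partial i (partial k phi)) p = partial k (partial i (partial i phi)) p.
Proof.
  intros Hp.
  assert (E : forall q, exterior q -> partial i (partial k phi) q = partial k (partial i phi) q).
  { intros q Hq; apply (smooth_partial_comm punctured_half_space);
      [exact Hphi|apply locally_punctured, Hq|apply Hq]. }
  rewrite (partial_eq_exterior i _ _ p (partial i (partial k (partial i phi)) p) E Hp).
  - apply (smooth_partial_comm punctured_half_space);
      [apply smooth_partial, Hphi|apply locally_punctured, Hp|apply Hp].
  - apply exterior_deriv_along; [repeat apply smooth_partial; exact Hphi|exact Hp].
Qed.

(** [box] commutes with [partial k], so this is the ugly equation differentiated; the correction
    comes from the [k]-derivative of [2 / r], which is [- 2 x_k / r^3] in space and zero in time. *)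
Lemma box_partial (k : axis) (p : event) : exterior p ->
  box (partial k phi) p = 2 / rad p * partial k (partial axT phi) p
    - (if axis_eqb k axT then 0 else 2 * coordinate k p / rad p ^ 3 * partial axT phi p).
Proof.
  intros Hp; assert (Hr := proj2 Hp); unfold box.
  rewrite !triple_comm by exact Hp.
  assert (E : partial k (box phi) p = - partial k (partial axT (partial axT phi)) p
    + partial k (partial ax1 (partial ax1 phi)) p + partial k (partial ax2 (partial ax2 phi)) p
    + partial k (partial ax3 (partial ax3 phi)) p).
  { eapply partial_eq_exterior; [intros q _; reflexivity|exact Hp|].
    unfold box; derive_along Hp. }
  rewrite <- E.
  eapply partial_eq_exterior;
    [intros q Hq; exact (Hugly q (exterior_punctured q Hq))|exact Hp|].
  unfold Rdiv.
  eapply deriv_along_eq.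
  - apply (deriv_along_mult k (fun q => 2 * / radius (snd q)) (partial axT phi)).
    + apply (deriv_along_mult k (fun _ => 2) (fun q => / radius (snd q)));
        [exact (deriv_along_const k 2 p)|derive_along Hp].
    + apply exterior_deriv_along; [apply smooth_partial, Hphi|exact Hp].
  - unfold rad.
    destruct k; simpl; field; apply Rgt_not_eq, Hr.
Qed.

Lemma box_phi1 (p : event) : exterior p -> box phi1 p = 0.
Proof.
  intros Hp; assert (Hr := proj2 Hp); change (0 < rad p) in Hr.
  assert (Hu := Hugly p (exterior_punctured p Hp)); change (radius (snd p)) with (rad p) in Hu.
  assert (HT := box_partial axT p Hp).
  assert (H1 := box_partial ax1 p Hp).
  assert (H2 := box_partial ax2 p Hp).
  assert (H3 := box_partial ax3 p Hp).
  assert (Hs : rad p ^ 2 = coordinate ax1 p ^ 2 + coordinate ax2 p ^ 2 + coordinate ax3 p ^ 2).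
  { unfold rad; destruct p as [T [[x1 x2] x3]]; apply radius_sqr. }
  simpl axis_eqb in *; cbv iota in *.
  (* Commutators of [box] with [r] and with [x . grad]: [grad r = x / r], the Laplacian of [r] is
     [3 / r - |x|^2 / r^3], and [x . grad] contributes twice the spatial Laplacian, written as
     [box phi + phi_TT]. *)
  transitivity (rad p * box (partial axT phi) p
    - (coordinate ax1 p * box (partial ax1 phi) p + coordinate ax2 p * box (partial ax2 phi) p
       + coordinate ax3 p * box (partial ax3 phi) p)
    + (3 * / rad p - (coordinate ax1 p ^ 2 + coordinate ax2 p ^ 2 + coordinate ax3 p ^ 2) / rad p ^ 3)
      * partial axT phi p
    + 2 / rad p * (coordinate ax1 p * partial ax1 (partial axT phi) p
      + coordinate ax2 p * partial ax2 (partial axT phi) p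
      + coordinate ax3 p * partial ax3 (partial axT phi) p)
    - 2 * (box phi p + partial axT (partial axT phi) p)).
  - unfold box at 1; rewrite partial_TT_phi1, !partial_2_space_phi1 by (exact Hp || discriminate).
    unfold box; field; lra.
  - rewrite HT, H1, H2, H3, Hu, <- Hs.
    (* After the ugly equation and its derivatives are inserted, all second derivatives cancel and a
       multiple of [phi_T] is left, whose coefficient vanishes by [|x|^2 = r^2]. *)
    transitivity ((2 / rad p ^ 3 * (coordinate ax1 p ^ 2 + coordinate ax2 p ^ 2 + coordinate ax3 p ^ 2)
       - 2 / rad p) * partial axT phi p); [field; lra|].
    rewrite <- Hs; field; lra.
Qed.
End RescaledUgly.

(** * Initial data and conclusion *)

(* Turns continuity on the closed half-space into continuity everywhere. *)
Definition clamp (p : event) : event := (Rmax 0 (fst p), snd p).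

Lemma clamp_id (p : event) : 0 <= fst p -> clamp p = p.
Proof. intros H; unfold clamp; rewrite Rmax_right by exact H; symmetry; apply surjective_pairing. Qed.

Lemma continuous_Rmax_0 (x : R) : continuous (Rmax 0) x.
Proof.
  apply continuous_ext with (fun x => (x + Rabs x) * / 2).
  - intros y; unfold Rmax, Rabs; destruct (Rle_dec 0 y), (Rcase_abs y); lra.
  - assert (H : continuous Rabs x) by apply continuous_Rabs. continuity_tac.
Qed.

Lemma continuous_clamp (p : event) : continuous clamp p.
Proof.
  apply continuous_pair; [|apply (continuous_snd (U := R_UniformSpace))].
  apply (continuous_Rcomp (Rmax 0)); [apply continuous_Rmax_0|].
  apply (continuous_fst (U := R_UniformSpace)).
Qed.

Lemma continuous_on_clamp (f : event -> R) (p : event) :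
  continuous_on half_space f -> continuous (fun q => f (clamp q)) p.
Proof.
  intros Hf Q HQ.
  assert (Hc : half_space (clamp p)) by apply Rmax_l.
  assert (H := continuous_clamp p _ (Hf (clamp p) Hc Q HQ)).
  change (locally p (fun q => half_space (clamp q) -> Q (f (clamp q)))) in H.
  change (locally p (fun q => Q (f (clamp q)))).
  revert H; apply filter_imp; intros q H; apply H, Rmax_l.
Qed.

Lemma clamp_locally_id (f : event -> R) (p : event) :
  0 < fst p -> locally p (fun q => f q = f (clamp q)).
Proof.
  intros Hp; generalize (locally_future p Hp); apply filter_imp; intros q Hq.
  rewrite clamp_id; [reflexivity|apply Rlt_le, Hq].
Qed.

(** Each partial derivative is clamped separately instead of differentiating the clamped function.
    The results are continuous across [T = 0] and agree with true derivatives for [T > 0], as [jet2]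
    requires. *)
Lemma smooth_clamp_jet2 (f : event -> R) : smooth_on half_space f ->
  jet2 (fun p => f (clamp p)) (fun i p => partial i f (clamp p))
    (fun i j p => partial i (partial j f) (clamp p)).
Proof.
  intros Hf.
  assert (Hcont : forall g, smooth_on half_space g -> forall p, continuous (fun q => g (clamp q)) p)
    by (intros g Hg p; apply continuous_on_clamp; exact (proj1 (Hg 0%nat))).
  assert (Hpart : forall g, smooth_on half_space g -> forall p, 0 < fst p ->
    has_partials (fun q => g (clamp q)) (fun i q => partial i g (clamp q)) p).
  { intros g Hg p Hp i; cbv beta; rewrite clamp_id by (apply Rlt_le, Hp).
    apply (deriv_along_ext i g (fun q => g (clamp q)) p); [apply clamp_locally_id, Hp|].
    apply (smooth_deriv_along half_space); [exact Hg|apply Rlt_le, Hp|exact Hp]. }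
  split; [|split; [|split; [|split; [|split]]]].
  - apply Hcont, Hf.
  - intros i; apply Hcont, smooth_partial, Hf.
  - intros i j; apply Hcont; do 2 apply smooth_partial; exact Hf.
  - apply Hpart, Hf.
  - intros j p Hp; apply (Hpart (partial j f)); [apply smooth_partial, Hf|exact Hp].
  - intros i j p Hp; rewrite clamp_id by (apply Rlt_le, Hp).
    apply (smooth_partial_comm half_space); [exact Hf| |exact Hp].
    generalize (locally_future p Hp); apply filter_imp; intros q Hq; apply Rlt_le, Hq.
Qed.

Lemma radius_axis1 (e : R) : 0 < e -> radius (e, 0, 0) = e.
Proof.
  intros H; unfold radius; replace (e ^ 2 + 0 ^ 2 + 0 ^ 2) with (e ^ 2) by ring.
  apply sqrt_pow2; lra.
Qed.

Lemma box_eq_0_extends (f : event -> R) :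
  smooth_on half_space f -> (forall p, exterior p -> box f p = 0) ->
  forall p, 0 < fst p -> box f p = 0.
Proof.
  intros Hf H0 p Hp.
  destruct (classic (exterior p)) as [He|He]; [apply H0, He|].
  destruct p as [T X]; cbn [fst] in Hp.
  assert (HX : X = (0, 0, 0)).
  { apply NNPP; intros HX; apply He; split; [exact Hp|apply radius_gt_0, HX]. }
  subst X; apply NNPP; intros Hn.
  assert (Hloc : locally (T, (0, 0, 0)) half_space).
  { generalize (locally_future (T, (0, 0, 0)) Hp); apply filter_imp; intros q Hq; apply Rlt_le, Hq. }
  assert (Hc : forall i, continuous (partial i (partial i f)) (T, (0, 0, 0))).
  { intros i; apply (smooth_continuous half_space); [do 2 apply smooth_partial; exact Hf|exact Hloc]. }
  assert (Hb : continuous (box f) (T, (0, 0, 0))).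
  { assert (cT := Hc axT); assert (c1 := Hc ax1); assert (c2 := Hc ax2); assert (c3 := Hc ax3).
    unfold box; continuity_tac. }
  assert (Hne : locally (box f (T, (0, 0, 0))) (fun y => y <> 0)).
  { apply (locally_open (fun y : R => y <> 0)); auto. apply open_neq. }
  destruct (Hb _ Hne) as [d Hd].
  assert (Hd0 := cond_pos d).
  apply (Hd (T, (d / 2, 0, 0))).
  - repeat split; try apply ball_center; cbn [fst snd].
    change (Rabs (d / 2 - 0) < d); rewrite Rabs_pos_eq; lra.
  - apply H0; split; cbn [fst snd]; [exact Hp|rewrite radius_axis1; lra].
Qed.

(** * Compactly supported data: uniform bounds and a common radius *)

(** The cover consists of the open sets on which [f] is bounded; a finite subcover has a largest
    bound. Applied to [radius] this puts the supports in a ball, applied to the data it bounds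
    them. *)
Lemma compact_bounded {U : UniformSpace} (K : U -> Prop) (f : U -> R) :
  is_compact K -> (forall x, continuous f x) -> exists M, forall x, K x -> Rabs (f x) <= M.
Proof.
  intros HK Hf.
  destruct (HK (fun O => open O /\ exists M, forall x, O x -> Rabs (f x) <= M)) as (l & Hl & Hcov).
  - intros O [HO _]; exact HO.
  - intros x _; exists (fun y => Rabs (f y) < Rabs (f x) + 1); split; [split|].
    + intros y Hy. apply (continuous_comp f Rabs y (Hf y) (continuous_Rabs _) (fun z => z < Rabs (f x) + 1)).
      apply (open_lt (Rabs (f x) + 1)); exact Hy.
    + exists (Rabs (f x) + 1); intros; lra.
    + lra.
  - assert (HM : exists M, forall O, In O l -> forall x, O x -> Rabs (f x) <= M).
    { clear Hcov; induction l as [|O l IH].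
      - exists 0; intros O [].
      - destruct IH as [M1 H1]; [intros; apply Hl; right; assumption|].
        destruct (Hl O (or_introl eq_refl)) as [_ [M2 H2]].
        exists (Rmax M1 M2); intros O' [<-|HO'] x Hx.
        + eapply Rle_trans; [apply (H2 x Hx)|apply Rmax_r].
        + eapply Rle_trans; [apply (H1 O' HO' x Hx)|apply Rmax_l]. }
    destruct HM as [M HM]; exists M; intros x Hx.
    destruct (Hcov x Hx) as (O & HO & HOx); exact (HM O HO x HOx).
Qed.

Lemma outside_support {U : UniformSpace} (g : U -> R) (x : U) :
  ~ support g x -> locally x (fun y => g y = 0).
Proof.
  intros H; apply NNPP in H; revert H; apply filter_imp; intros y; apply NNPP.
Qed.

Lemma locally_fixed_time (T : R) (X : space) (Q : space -> Prop) :
  locally X Q -> locally (T, X) (fun q : event => Q (snd q)).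
Proof. apply (continuous_snd (U := R_UniformSpace) T X). Qed.

(** Spatial derivatives at [T = 0] are ordinary derivatives within the initial slice, so they see
    only [f (0, _)]. The time derivative does not, which is why its support is a separate hypothesis
    later. *)
Lemma initial_gradient_zero (f : event -> R) (i : axis) (X : space) : i <> axT ->
  locally X (fun Y => f (0, Y) = 0) -> partial i f (0, X) = 0.
Proof.
  intros Hi H; apply partial_eq; [apply two_sided_spatial; [exact Hi|apply Rle_refl]|].
  unfold deriv_along; eapply is_derive_ext_loc; [|apply (is_derive_const (V := R_NormedModule) 0)].
  generalize (locally_set_coordinate i (0, X) _ (locally_fixed_time 0 X _ H)).
  apply filter_imp; intros s Hs.
  destruct X as [[x1 x2] x3], i; [congruence| | |]; symmetry; exact Hs.
Qed.

Lemma initial_bounds (f : event -> R) : smooth_on half_space f ->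
  compactly_supported (fun X => f (0, X)) ->
  compactly_supported (fun X => partial axT f (0, X)) ->
  exists M rho, 1 <= rho /\
    (forall X, Rabs (f (0, X)) <= M /\ forall i, Rabs (partial i f (0, X)) <= M) /\
    (forall X, rho < radius X -> f (0, X) = 0 /\ forall i, partial i f (0, X) = 0).
Proof.
  intros Hf Hg Hh.
  assert (Hc : forall g, smooth_on half_space g -> forall X, continuous (fun X => g (0, X)) X).
  { intros g Hg0 X.
    apply continuous_ext with (fun X : space => g (clamp (0, X))).
    { intros Y; rewrite clamp_id; [reflexivity|apply Rle_refl]. }
    apply (continuous_comp (fun X : space => (0, X) : event) (fun p => g (clamp p))).
    - apply continuous_pair; [apply continuous_const|apply continuous_id].
    - apply continuous_on_clamp; exact (proj1 (Hg0 0%nat)). }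
  destruct (compact_bounded _ radius Hg continuous_radius) as [r1 Hr1].
  destruct (compact_bounded _ radius Hh continuous_radius) as [r2 Hr2].
  destruct (compact_bounded _ _ Hg (Hc f Hf)) as [M0 HM0].
  destruct (compact_bounded _ _ Hh (Hc _ (smooth_partial _ _ axT Hf))) as [MT HMT].
  destruct (compact_bounded _ _ Hg (Hc _ (smooth_partial _ _ ax1 Hf))) as [M1 HM1].
  destruct (compact_bounded _ _ Hg (Hc _ (smooth_partial _ _ ax2 Hf))) as [M2 HM2].
  destruct (compact_bounded _ _ Hg (Hc _ (smooth_partial _ _ ax3 Hf))) as [M3 HM3].
  set (g := fun X : space => f (0, X)) in *.
  set (h := fun X : space => partial axT f (0, X)) in *.
  assert (Zg : forall X, ~ support g X -> g X = 0 /\ forall i, i <> axT -> partial i f (0, X) = 0).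
  { intros X HX; apply outside_support in HX; split; [exact (locally_singleton _ _ HX)|].
    intros i Hi; apply initial_gradient_zero; [exact Hi|exact HX]. }
  assert (Zh : forall X, ~ support h X -> h X = 0).
  { intros X HX; apply outside_support in HX; exact (locally_singleton _ _ HX). }
  (* Absolute values make the sum dominate every summand even when a support is empty and its bound
     is negative. The maximum with 1 provides [1 <= rho]. *)
  exists (Rabs M0 + Rabs MT + Rabs M1 + Rabs M2 + Rabs M3), (Rmax 1 (Rmax r1 r2)).
  split; [apply Rmax_l|split; intros X].
  - assert (HZ : forall y N, y = 0 -> Rabs y <= Rabs N)
      by (intros y N ->; rewrite Rabs_R0; apply Rabs_pos).
    assert (HN : forall y N, Rabs y <= N -> Rabs y <= Rabs N)
      by (intros y N Hy; exact (Rle_trans _ _ _ Hy (Rle_abs N))).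
    assert (Bg : Rabs (g X) <= Rabs M0 /\ Rabs (partial ax1 f (0, X)) <= Rabs M1 /\
       Rabs (partial ax2 f (0, X)) <= Rabs M2 /\ Rabs (partial ax3 f (0, X)) <= Rabs M3).
    { destruct (classic (support g X)) as [HX|HX].
      - repeat split; apply HN;
          [exact (HM0 X HX)|exact (HM1 X HX)|exact (HM2 X HX)|exact (HM3 X HX)].
      - destruct (Zg X HX) as [Z0 Z]; repeat split; apply HZ; [exact Z0| | |];
          apply Z; discriminate. }
    assert (Bh : Rabs (h X) <= Rabs MT).
    { destruct (classic (support h X)) as [HX|HX]; [apply HN, (HMT X HX)|apply HZ, (Zh X HX)]. }
    destruct Bg as (B0 & B1 & B2 & B3).
    generalize (Rabs_pos M0) (Rabs_pos MT) (Rabs_pos M1) (Rabs_pos M2) (Rabs_pos M3); intros.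
    split; [|intros i; destruct i];
      (eapply Rle_trans; [first [exact B0|exact Bh|exact B1|exact B2|exact B3]|lra]).
  - intros HX.
    assert (Hr : Rabs (radius X) = radius X) by (apply Rabs_pos_eq, radius_ge_0).
    generalize (Rmax_r 1 (Rmax r1 r2)) (Rmax_l r1 r2) (Rmax_r r1 r2); intros.
    assert (Ng : ~ support g X) by (intros S; assert (K := Hr1 X S); change (Rabs (radius X) <= r1) in K; lra).
    assert (Nh : ~ support h X) by (intros S; assert (K := Hr2 X S); change (Rabs (radius X) <= r2) in K; lra).
    destruct (Zg X Ng) as [Z0 Z]; split; [exact Z0|].
    intros i; destruct i; [exact (Zh X Nh)| | |]; apply Z; discriminate.
Qed.

Lemma drop_weight (v r t C : R) : 0 < r -> 0 <= t ->
  (1 + t + r) * sqrt (1 + Rabs (t - r)) * Rabs (r * v) <= C -> Rabs v <= C / (r * (1 + t + r)).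
Proof.
  intros Hr Ht; rewrite Rabs_mult, (Rabs_pos_eq r) by lra; intros H.
  assert (Hs : 1 <= sqrt (1 + Rabs (t - r))).
  { rewrite <- sqrt_1 at 1; apply sqrt_le_1_alt; generalize (Rabs_pos (t - r)); lra. }
  apply Rle_div_r; [apply Rmult_lt_0_compat; lra|].
  eapply Rle_trans; [|exact H].
  assert (Ha : 0 <= (1 + t + r) * (r * Rabs v)).
  { apply Rmult_le_pos; [lra|apply Rmult_le_pos; [lra|apply Rabs_pos]]. }
  nra.
Qed.

Theorem mainTheorem2 :
  forall phi phi1 : event -> R,
    smooth_on punctured_half_space phi ->
    (forall p, punctured_half_space p ->
       box phi p = 2 / radius (snd p) * partial axT phi p) ->
    smooth_on half_space phi1 ->
    (forall p, punctured_half_space p ->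
       phi1 p = radius (snd p) * nabla_psi phi p) ->
    compactly_supported (fun X : space => phi1 (0, X)) ->
    compactly_supported (fun X : space => partial axT phi1 (0, X)) ->
    (exists C : R, forall (T : R) (X : space), 0 <= T -> X <> (0, 0, 0) ->
       (1 + T + radius X) * sqrt (1 + Rabs (T - radius X))
         * Rabs (radius X * nabla_psi phi (T, X)) <= C) /\
    (exists C : R, forall (T : R) (X : space), 0 <= T -> X <> (0, 0, 0) ->
       Rabs (nabla_psi phi (T, X)) <= C / (radius X * (1 + T + radius X))).
Proof.
  intros phi phi1 Hphi Hugly Hs1 Hphi1 Hg Hh.
  destruct (initial_bounds phi1 Hs1 Hg Hh) as (M & rho & Hrho & HM & Hsupp).
  assert (Hbox := box_eq_0_extends phi1 Hs1 (box_phi1 phi phi1 Hphi Hugly Hphi1)).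
  destruct (wave_decay _ _ _ M rho (smooth_clamp_jet2 phi1 Hs1)) with (4 := Hrho) as [C HC].
  - intros p Hp; rewrite clamp_id by (apply Rlt_le, Hp).
    generalize (Hbox p Hp); unfold box; lra.
  - intros X; rewrite clamp_id by apply Rle_refl; exact (HM X).
  - intros X HX; rewrite clamp_id by apply Rle_refl; exact (Hsupp X HX).
  - assert (Hmain : forall T X, 0 <= T -> X <> (0, 0, 0) ->
       (1 + T + radius X) * sqrt (1 + Rabs (T - radius X))
         * Rabs (radius X * nabla_psi phi (T, X)) <= C).
    { intros T X HT HX.
      assert (E : phi1 (T, X) = radius X * nabla_psi phi (T, X))
        by (apply (Hphi1 (T, X)); split; [exact HT|apply radius_gt_0, HX]).
      rewrite <- E; generalize (HC T X HT); rewrite clamp_id by exact HT; trivial. }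
    split; exists C; [exact Hmain|]; intros T X HT HX.
    exact (drop_weight _ _ T C (radius_gt_0 X HX) HT (Hmain T X HT HX)).
Qed.
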